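(* Let $M=M_1\times_fM_2$ be a Lyra twisted warped product with scale $\varphi$, $k=\ln f$, $\sigma=\ln\varphi$, $n_i=\dim M_i$, $n=n_1+n_2$. Assume $n_2>1$ and that the Lyra scale depends only on the fiber: $\sigma=\sigma_2$ with $\sigma_2\in C^\infty(M_2)$. Set $\alpha=\frac{n-2}{n_2-1}$. Then the mixed soliton equation $$(n_2-1)XU(k)+(n-2)\big[XU(\sigma)-X(k)U(\sigma)-X(\sigma)U(\sigma)\big]=0\quad\text{for all horizontal lifts }X\text{ and vertical lifts }U$$ is equivalent to $$U\big(e^{-\alpha\sigma_2}X(k)\big)=0\quad\text{for all horizontal lifts }X\text{ and vertical lifts }U .$$ Consequently, when this equation holds, on every simply connected product neighborhood $W_1\times W_2$ there are smooth functions $k_1$ on $W_1$ and $k_2$ on $W_2$ such that $$k(x,y)=e^{\alpha\sigma_2(y)}k_1(x)+k_2(y),$$ or equivalently, with $f_2=e^{k_2}$, $$f(x,y)=f_2(y)\exp\big(e^{\alpha\sigma_2(y)}k_1(x)\big).$$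
   Context: Lyra twisted warped product: $(M_1,g_1),(M_2,g_2)$ are smooth pseudo-Riemannian manifolds of positive dimensions; $f,\varphi:M_1\times M_2\to(0,\infty)$ are smooth; $M=M_1\times M_2$ carries $g=g_1\oplus f^2g_2$ and $g_L=\varphi^2g$. Horizontal (vertical) lifts are canonical lifts to $M$ of vector fields on $M_1$ ($M_2$); $XU(h)=X(U(h))$. Simply connected includes connected. The displayed mixed soliton equation is the horizontal--vertical component $\operatorname{Ric}^L(X,U)=0$ of the Lyra almost Ricci--Bourguignon soliton equation $\operatorname{Ric}^L+\frac12\mathcal L_Zg_L=(\lambda+\rho R^L)g_L$ with projectable potential $Z=Z_1+Z_2$ (a sum of lifts from the factors); $\operatorname{Ric}^L,R^L$ are the Ricci tensor and scalar curvature of $g_L$. *)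

(* Defs.v *)
From HB Require Import structures.
From mathcomp Require Import all_boot all_order all_algebra.
From mathcomp Require Import all_classical all_reals all_analysis.
Set Implicit Arguments.
Unset Strict Implicit.
Unset Printing Implicit Defensive.
Import Order.TTheory GRing.Theory Num.Theory.
Import numFieldNormedType.Exports.
Local Open Scope classical_set_scope.
Local Open Scope ring_scope.

(** [Ck k U f]: [f] is of class C^k on the open set [U]; the values of [f]
    outside [U] are irrelevant.  The source is finite-dimensional in all uses
    below, so that the derivative is C^k as an operator-valued map iff
    ['D_v f] is C^k for every [v]. *)
Fixpoint Ck (R : realType) (V W : normedModType R) (k : nat) (U : set V)
    (f : V -> W) : Prop :=
  if k is k'.+1 then
    (forall x, U x -> differentiable f x) /\ (forall v, Ck k' U ('D_v f))
  else forall x, U x -> {for x, continuous f}.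

Definition smooth (R : realType) (V W : normedModType R) (U : set V)
    (f : V -> W) : Prop := forall k, Ck k U f.

Section SmoothTheory.
Context {R : realType}.
Implicit Types V W : normedModType R.

Lemma Ck_subset V W k (U U' : set V) (f : V -> W) :
  U' `<=` U -> Ck k U f -> Ck k U' f.
Proof.
move=> UU'; elim: k f => [|k IH] f /=; first by move=> h x /UU'/h.
by move=> [h1 h2]; split=> [x /UU'/h1//|v]; exact/IH/h2.
Qed.

Lemma smooth_subset V W (U U' : set V) (f : V -> W) :
  U' `<=` U -> smooth U f -> smooth U' f.
Proof. by move=> UU' Uf k; exact: Ck_subset (Uf k). Qed.

Lemma near0_differentiable V W (h : V -> W) x :
  (\near x, h x = 0) -> differentiable h x.
Proof.
move=> h0.
have e : h \o shift x = cst (h x) + (\0 : V -> W) +o_ 0 id.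
  apply/eqaddoP => _/posnumP[e]; near=> y.
  rewrite /= (nbhs_singleton h0) !fctE addr0 subr0.
  suff -> : h (y + x) = 0 by rewrite normr0 mulr_ge0.
  near: y; move: h0; rewrite (near_shift 0) /=.
  by apply: filterS => z; rewrite /= subr0.
have d0 : 'd h x = \0 :> (V -> W).
  by apply: (diff_unique _ e); exact: cst_continuous.
by apply/diff_locallyP; split; rewrite d0 //; exact: cst_continuous.
Unshelve. all: by end_near. Qed.

Lemma near_eq_differentiable V W (f g : V -> W) x :
  (\near x, f x = g x) -> differentiable f x -> differentiable g x.
Proof.
move=> fg df; have -> : g = f - (f - g) by rewrite opprB addrC subrK.
apply: differentiableB => //; apply: near0_differentiable.
by apply: filterS fg => y /= fgy; rewrite !fctE fgy subrr.
Qed.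

Lemma Ck_eq V W k (U : set V) (f g : V -> W) :
  open U -> (forall x, U x -> f x = g x) -> Ck k U f -> Ck k U g.
Proof.
move=> oU; elim: k f g => [|k IH] f g fg /=.
- move=> h x Ux; have nfg : {near x, f =1 g}.
    by apply: filterS (open_nbhs_nbhs (conj oU Ux)) => y; exact: fg.
  rewrite /prop_for/continuous_at -(nbhs_singleton nfg).
  by apply: cvg_trans (h x Ux); apply: near_eq_cvg; apply: filterS nfg.
- have nfg x : U x -> \near x, f x = g x.
    by move=> Ux; apply: filterS (open_nbhs_nbhs (conj oU Ux)) => y; exact: fg.
  move=> [h1 h2]; split.
  + by move=> x Ux; apply: near_eq_differentiable (nfg x Ux) (h1 _ Ux).
  + move=> v; apply: (IH ('D_v f)) => // x Ux.
    exact/near_eq_derive/nfg.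
Qed.

Lemma derive_precomp V V' W (L : {linear V' -> V}) (f : V -> W) x v :
  'D_v (f \o L) x = 'D_(L v) f (L x).
Proof.
rewrite /derive.
have e (h : R) : L (h *: v + x) = h *: L v + L x.
  by rewrite (linearD L) (linearZ_LR L).
have -> : (fun h : R => h^-1 *: ((f \o L) (h *: v + x) - (f \o L) x)) =
  (fun h : R => h^-1 *: (f (h *: L v + L x) - f (L x))).
  apply/funext => h; congr (_ *: (f _ - _)); exact: e.
reflexivity.
Qed.

Lemma Ck_precomp V V' W k (U : set V) (L : {linear V' -> V}) (f : V -> W) :
  continuous L -> Ck k U f -> Ck k (L @^-1` U) (f \o L).
Proof.
move=> cL; elim: k f => [|k IH] f /=.
  by move=> h x Ux; apply: continuous_comp; [exact: cL|exact: h].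
move=> [h1 h2]; split=> [x Ux|v].
  by apply: differentiable_comp; [exact: linear_differentiable|exact: h1].
have E : 'D_v (f \o L) = 'D_(L v) f \o L.
  by apply/funext => x; exact: derive_precomp.
rewrite E; exact: IH.
Qed.

Lemma Ck_postcomp V W W' k (U : set V) (L : {linear W -> W'}) (f : V -> W) :
  open U -> continuous L -> Ck k U f -> Ck k U (L \o f).
Proof.
move=> oU cL; elim: k f => [|k IH] f /=.
  by move=> h x Ux; apply: continuous_comp; [exact: h|exact: cL].
move=> [h1 h2]; split=> [x Ux|v].
  by apply: differentiable_comp; [exact: h1|exact: linear_differentiable].
apply: (Ck_eq oU) (IH _ (h2 v)) => x Ux /=.
have dL y : differentiable L y by exact: linear_differentiable.
have df := h1 _ Ux.
have dLf : differentiable (L \o f) x by exact: differentiable_comp.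
rewrite (deriveE v df) (deriveE v dLf) (diff_comp df (dL _)) /=.
by rewrite (diff_lin _ cL).
Qed.

Lemma CkD V W k (U : set V) (f g : V -> W) :
  open U -> Ck k U f -> Ck k U g -> Ck k U (f + g).
Proof.
move=> oU; elim: k f g => [|k IH] f g /=.
  by move=> hf hg x Ux; apply: continuousD; [exact: hf|exact: hg].
move=> [f1 f2] [g1 g2]; split=> [x Ux|v].
  by apply: differentiableD; [exact: f1|exact: g1].
apply: (Ck_eq oU) (IH _ _ (f2 v) (g2 v)) => x Ux.
by rewrite [RHS]deriveD//; apply: diff_derivable; [exact: f1|exact: g1].
Qed.

Lemma continuous_mxcoord (T : topologicalType) m n (f : T -> 'M[R]_(m, n)) x :
  (forall i j, {for x, continuous (fun y => f y i j)}) -> {for x, continuous f}.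
Proof.
move=> h; apply/cvgrPdist_le => /= e e0; near=> y.
rewrite [leLHS]/Num.Def.normr/= mx_normrE (bigmax_le _ (ltW e0))//= => i _.
rewrite !mxE; move: i; near: y; apply: filter_forall => /= i.
by have /cvgrPdist_le/(_ _ e0) := h i.1 i.2.
Unshelve. all: by end_near. Qed.

Lemma continuous_row_mx (T : topologicalType) n1 n2 (f : T -> 'rV[R]_n1)
    (g : T -> 'rV[R]_n2) x : {for x, continuous f} -> {for x, continuous g} ->
  {for x, continuous (fun y => row_mx (f y) (g y))}.
Proof.
move=> cf cg; apply: continuous_mxcoord => i j; rewrite -(splitK j).
case: (fintype.split j) => {}j /=.
- rewrite (_ : (fun _ => _) = (fun M : 'rV_n1 => M i j) \o f).
    by apply: continuous_comp => //; exact: coord_continuous.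
  by apply/funext => y /=; rewrite row_mxEl.
- rewrite (_ : (fun _ => _) = (fun M : 'rV_n2 => M i j) \o g).
    by apply: continuous_comp => //; exact: coord_continuous.
  by apply/funext => y /=; rewrite row_mxEr.
Qed.

Definition inl_rV n1 n2 (v : 'rV[R]_n1) : 'rV[R]_(n1 + n2) := row_mx v 0.
Definition inr_rV n1 n2 (v : 'rV[R]_n2) : 'rV[R]_(n1 + n2) := row_mx 0 v.

Lemma inl_rV_linear n1 n2 : linear (@inl_rV n1 n2).
Proof. by move=> a u v; rewrite /inl_rV scale_row_mx add_row_mx scaler0 addr0. Qed.

Lemma inr_rV_linear n1 n2 : linear (@inr_rV n1 n2).
Proof. by move=> a u v; rewrite /inr_rV scale_row_mx add_row_mx scaler0 addr0. Qed.

HB.instance Definition _ n1 n2 :=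
  GRing.isLinear.Build R _ _ _ _ (@inl_rV_linear n1 n2).
HB.instance Definition _ n1 n2 :=
  GRing.isLinear.Build R _ _ _ _ (@inr_rV_linear n1 n2).

Lemma inl_rV_continuous n1 n2 : continuous (@inl_rV n1 n2).
Proof.
move=> v; apply: (@continuous_row_mx 'rV_n1 n1 n2 id (cst 0) v); first exact: cvg_id.
exact: cst_continuous.
Qed.

Lemma inr_rV_continuous n1 n2 : continuous (@inr_rV n1 n2).
Proof.
move=> v; apply: (@continuous_row_mx 'rV_n2 n1 n2 (cst 0) id v); last exact: cvg_id.
exact: cst_continuous.
Qed.

Lemma row_mxE V n1 n2 (f : V -> 'rV[R]_n1) (g : V -> 'rV[R]_n2) :
  (fun x => row_mx (f x) (g x)) = (@inl_rV n1 n2 \o f) + (@inr_rV n1 n2 \o g).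
Proof.
by apply/funext => x; rewrite fctE /= /inl_rV /inr_rV add_row_mx addr0 add0r.
Qed.

Lemma Ck_row_mx V n1 n2 k (U : set V) (f : V -> 'rV[R]_n1) (g : V -> 'rV[R]_n2) :
  open U -> Ck k U f -> Ck k U g -> Ck k U (fun x => row_mx (f x) (g x)).
Proof.
move=> oU Uf Ug; rewrite row_mxE; apply: CkD => //.
- by apply: Ck_postcomp => //; exact: inl_rV_continuous.
- by apply: Ck_postcomp => //; exact: inr_rV_continuous.
Qed.

Lemma Ck_cst V W k (U : set V) (a : W) : Ck k U (cst a : V -> W).
Proof.
elim: k a => [|k IH] a /=; first by move=> x _; exact: cst_continuous.
split=> [x _|v]; first exact: differentiable_cst.
by rewrite (_ : 'D_v _ = cst 0)//; apply/funext => x; exact: derive_cst.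
Qed.

Lemma derive_row_mx V n1 n2 (f : V -> 'rV[R]_n1) (g : V -> 'rV[R]_n2) x v :
  derivable f x v -> derivable g x v ->
  'D_v (fun x => row_mx (f x) (g x)) x = row_mx ('D_v f x) ('D_v g x).
Proof.
move=> df dg; apply/cvg_lim => //.
have -> : (fun h : R => h^-1 *: (row_mx (f (h *: v + x)) (g (h *: v + x)) -
      row_mx (f x) (g x))) =
    (fun h : R => row_mx (h^-1 *: (f (h *: v + x) - f x))
                         (h^-1 *: (g (h *: v + x) - g x))).
  apply/funext => h.
  by rewrite opp_row_mx add_row_mx scale_row_mx.
have -> : (fun h : R => row_mx (h^-1 *: (f (h *: v + x) - f x))
                         (h^-1 *: (g (h *: v + x) - g x))) =
   (@inl_rV n1 n2 \o (fun h : R => h^-1 *: (f (h *: v + x) - f x))) +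
   (@inr_rV n1 n2 \o (fun h : R => h^-1 *: (g (h *: v + x) - g x))).
  by apply/funext => h; rewrite fctE /= /inl_rV /inr_rV add_row_mx addr0 add0r.
have -> : row_mx ('D_v f x) ('D_v g x) =
    inl_rV n2 ('D_v f x) + inr_rV n1 ('D_v g x).
  by rewrite /inl_rV /inr_rV add_row_mx addr0 add0r.
apply: cvgD.
- exact: (cvg_comp _ _ df (@inl_rV_continuous n1 n2 _)).
- exact: (cvg_comp _ _ dg (@inr_rV_continuous n1 n2 _)).
Qed.

End SmoothTheory.

(** [chart_map] and [chart_inv] are total functions; only their values on
    [chart_dom] and [chart_ran] matter. *)
Record chart (R : realType) (n : nat) (M : topologicalType) := Chart {
  chart_map :> M -> 'rV[R]_n;
  chart_inv : 'rV[R]_n -> M;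
  chart_dom : set M;
  chart_ran : set 'rV[R]_n;
  chart_dom_open : open chart_dom;
  chart_ran_open : open chart_ran;
  chart_mapP : forall p, chart_dom p -> chart_ran (chart_map p);
  chart_invP : forall z, chart_ran z -> chart_dom (chart_inv z);
  chart_mapK : forall p, chart_dom p -> chart_inv (chart_map p) = p;
  chart_invK : forall z, chart_ran z -> chart_map (chart_inv z) = z;
  chart_map_continuous :
    forall p, chart_dom p -> {for p, continuous chart_map};
  chart_inv_continuous :
    forall z, chart_ran z -> {for z, continuous chart_inv} }.

(** Hausdorff, second countable smooth manifolds of dimension [n], without
    boundary.  [chart_at] selects, for each point, a chart of the atlas around
    it; it serves to represent tangent vectors (see [tangent]). *)
Record manifold (R : realType) (n : nat) := Manifold {
  carrier :> topologicalType;
  atlas : set (chart R n carrier);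
  chart_at : carrier -> chart R n carrier;
  manifold_hausdorff : hausdorff_space carrier;
  manifold_second_countable : @second_countable carrier;
  chart_at_atlas : forall p, atlas (chart_at p);
  chart_at_dom : forall p, chart_dom (chart_at p) p;
  atlas_compatible : forall c d, atlas c -> atlas d ->
    smooth (chart_ran c `&` chart_inv c @^-1` chart_dom d)
           (chart_map d \o chart_inv c) }.

(** Smoothness of [h] on the open subset [A] of [M]; the values of [h] outside
    [A] are irrelevant. *)
Definition smooth_on (R : realType) (n : nat) (M : manifold R n)
    (W : normedModType R) (A : set M) (h : M -> W) : Prop :=
  forall c, atlas c ->
    smooth (chart_ran c `&` chart_inv c @^-1` A) (h \o chart_inv c).

(** A tangent vector at [p] is given by its components in the coordinates
    [chart_at p]. *)
Definition tangent (R : realType) (n : nat) (M : manifold R n) (p : M) :=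
  'rV[R]_n.

(** [X] need not be smooth here; by the chain rule the value is the one given by
    any other chart around the point. *)
Definition field_derive (R : realType) (n : nat) (M : manifold R n)
    (W : normedModType R) (X : forall p : M, tangent p) (h : M -> W) : M -> W :=
  fun p => 'D_(X p) (h \o chart_inv (chart_at p)) (chart_at p p).

(** [field_derive X c] are the components of [X] in the chart [c]. *)
Record vector_field (R : realType) (n : nat) (M : manifold R n) := VectorField {
  vf_val :> forall p : M, tangent p;
  vf_smooth : forall c, atlas c ->
    smooth_on (chart_dom c) (field_derive vf_val (chart_map c)) }.

Section ManifoldTheory.
Context {R : realType} {n : nat}.

Lemma open_chart_preim (M : topologicalType) (c : chart R n M) (A : set M) :
  open A -> open (chart_ran c `&` chart_inv c @^-1` A).
Proof.
move=> oA; rewrite openE => z [cz Az].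
have n1 : nbhs z (chart_ran c) := open_nbhs_nbhs (conj (@chart_ran_open _ _ _ c) cz).
have n2 : nbhs z (chart_inv c @^-1` A).
  by apply: (chart_inv_continuous cz); exact: open_nbhs_nbhs (conj oA Az).
exact: filterI n1 n2.
Qed.

End ManifoldTheory.

Section Product.
Context {R : realType} {n1 n2 : nat}.

Lemma open_setX_prod (T1 T2 : topologicalType) (A : set T1) (B : set T2) :
  open A -> open B -> open (A `*` B).
Proof.
move=> oA oB; rewrite openE => -[x y] [/= Ax By].
exists (A, B) => //=; split; first exact: open_nbhs_nbhs (conj oA Ax).
exact: open_nbhs_nbhs (conj oB By).
Qed.

Section Chart.
Context {M1 M2 : topologicalType} (c1 : chart R n1 M1) (c2 : chart R n2 M2).

Definition prod_chart_map (p : M1 * M2) : 'rV[R]_(n1 + n2) :=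
  row_mx (c1 p.1) (c2 p.2).

Definition prod_chart_inv (z : 'rV[R]_(n1 + n2)) : M1 * M2 :=
  (chart_inv c1 (lsubmx z), chart_inv c2 (rsubmx z)).

Definition prod_chart_dom : set (M1 * M2) := chart_dom c1 `*` chart_dom c2.

Definition prod_chart_ran : set 'rV[R]_(n1 + n2) :=
  lsubmx @^-1` chart_ran c1 `&` rsubmx @^-1` chart_ran c2.

Lemma prod_chart_dom_open : open prod_chart_dom.
Proof. by apply: open_setX_prod; exact: chart_dom_open. Qed.

Lemma prod_chart_ran_open : open prod_chart_ran.
Proof.
apply: openI; apply: open_comp; try exact: chart_ran_open.
- by move=> z _; exact: continuous_lsubmx.
- by move=> z _; exact: continuous_rsubmx.
Qed.

Lemma prod_chart_mapP p : prod_chart_dom p -> prod_chart_ran (prod_chart_map p).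
Proof.
by move=> [p1 p2]; split; rewrite /= ?row_mxKl ?row_mxKr; exact: chart_mapP.
Qed.

Lemma prod_chart_invP z : prod_chart_ran z -> prod_chart_dom (prod_chart_inv z).
Proof. by move=> [z1 z2]; split; exact: chart_invP. Qed.

Lemma prod_chart_mapK p :
  prod_chart_dom p -> prod_chart_inv (prod_chart_map p) = p.
Proof.
case: p => x y [/= p1 p2].
by rewrite /prod_chart_inv row_mxKl row_mxKr !chart_mapK.
Qed.

Lemma prod_chart_invK z :
  prod_chart_ran z -> prod_chart_map (prod_chart_inv z) = z.
Proof.
by move=> [z1 z2]; rewrite /prod_chart_map /= !chart_invK// hsubmxK.
Qed.

Lemma prod_chart_map_continuous p :
  prod_chart_dom p -> {for p, continuous prod_chart_map}.
Proof.
case: p => x y [/= p1 p2].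
apply: (@continuous_row_mx _ _ n1 n2 (c1 \o fst) (c2 \o snd)).
- by apply: continuous_comp; [exact: cvg_fst|exact: chart_map_continuous].
- by apply: continuous_comp; [exact: cvg_snd|exact: chart_map_continuous].
Qed.

Lemma prod_chart_inv_continuous z :
  prod_chart_ran z -> {for z, continuous prod_chart_inv}.
Proof.
move=> [z1 z2].
have l : {for z, continuous (chart_inv c1 \o lsubmx)}.
  apply: continuous_comp; first exact: continuous_lsubmx.
  exact: chart_inv_continuous.
have r : {for z, continuous (chart_inv c2 \o rsubmx)}.
  apply: continuous_comp; first exact: continuous_rsubmx.
  exact: chart_inv_continuous.
exact: cvg_pair l r.
Qed.

Definition prod_chart : chart R (n1 + n2) (M1 * M2)%type :=
  Chart prod_chart_dom_open prod_chart_ran_open prod_chart_mapP prod_chart_invP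
    prod_chart_mapK prod_chart_invK prod_chart_map_continuous
    prod_chart_inv_continuous.

End Chart.

Lemma prod_hausdorff (T1 T2 : topologicalType) :
  hausdorff_space T1 -> hausdorff_space T2 -> hausdorff_space (T1 * T2)%type.
Proof.
move=> h1 h2 [x1 x2] [y1 y2] cl; congr pair.
- apply: h1 => A B Ax By.
  have A' : nbhs (x1, x2) (A `*` setT).
    by exists (A, setT) => //; split=> //; exact: filterT.
  have B' : nbhs (y1, y2) (B `*` setT).
    by exists (B, setT) => //; split=> //; exact: filterT.
  by have [[a b] [[Aa _] [Ba _]]] := cl _ _ A' B'; exists a.
- apply: h2 => A B Ax By.
  have A' : nbhs (x1, x2) (setT `*` A).
    by exists (setT, A) => //; split=> //; exact: filterT.
  have B' : nbhs (y1, y2) (setT `*` B).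
    by exists (setT, B) => //; split=> //; exact: filterT.
  by have [[a b] [[_ Ab] [_ Bb]]] := cl _ _ A' B'; exists b.
Qed.

Lemma prod_second_countable (T1 T2 : topologicalType) :
  @second_countable T1 -> @second_countable T2 ->
  @second_countable (T1 * T2)%type.
Proof.
move=> [B1 cB1 [oB1 bB1]] [B2 cB2 [oB2 bB2]].
exists [set U.1 `*` U.2 | U in B1 `*` B2].
  exact/card_le_trans/countableX/cB2/cB1/card_image_le.
split=> [_ [[U V] [/= BU BV] <-]|[x y] A [[P Q] [/= Px Qy] PQA]].
  by apply: open_setX_prod; [exact: oB1|exact: oB2].
have [U [BU Ux] UP] := bB1 x P Px; have [V [BV Vy] VQ] := bB2 y Q Qy.
exists (U `*` V); first by split=> //; exists (U, V).
by move=> [a b] [/= Ua Vb]; apply: PQA; split; [exact: UP|exact: VQ].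
Qed.

Context (M1 : manifold R n1) (M2 : manifold R n2).

Definition prod_atlas : set (chart R (n1 + n2) (M1 * M2)%type) :=
  [set prod_chart c.1 c.2 | c in @atlas _ _ M1 `*` @atlas _ _ M2].

Definition prod_chart_at (p : M1 * M2) : chart R (n1 + n2) (M1 * M2)%type :=
  prod_chart (chart_at p.1) (chart_at p.2).

Lemma prod_chart_at_atlas p : prod_atlas (prod_chart_at p).
Proof.
by exists (chart_at p.1, chart_at p.2) => //; split; exact: chart_at_atlas.
Qed.

Lemma prod_chart_at_dom p : chart_dom (prod_chart_at p) p.
Proof. by split; exact: chart_at_dom. Qed.

Lemma prod_atlas_compatible c d : prod_atlas c -> prod_atlas d ->
  smooth (chart_ran c `&` chart_inv c @^-1` chart_dom d)
         (chart_map d \o chart_inv c).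
Proof.
move=> [[c1 c2] [/= a1 a2] <-] [[d1 d2] [/= b1 b2] <-] k.
apply: (@Ck_row_mx _ _ _ _ _ _ ((d1 \o chart_inv c1) \o lsubmx)
  ((d2 \o chart_inv c2) \o rsubmx)).
- apply: (@open_chart_preim _ _ _ (prod_chart c1 c2)); exact: prod_chart_dom_open.
- apply: (Ck_subset _ (Ck_precomp (@continuous_lsubmx _ _ _ _)
    (atlas_compatible a1 b1 k))).
  by move=> z [[z1 z2] [w1 w2]].
- apply: (Ck_subset _ (Ck_precomp (@continuous_rsubmx _ _ _ _)
    (atlas_compatible a2 b2 k))).
  by move=> z [[z1 z2] [w1 w2]].
Qed.

Definition prod_manifold : manifold R (n1 + n2) :=
  @Manifold R (n1 + n2) (M1 * M2)%type prod_atlas prod_chart_at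
    (prod_hausdorff (@manifold_hausdorff _ _ M1) (@manifold_hausdorff _ _ M2))
    (prod_second_countable (@manifold_second_countable _ _ M1)
      (@manifold_second_countable _ _ M2))
    prod_chart_at_atlas prod_chart_at_dom prod_atlas_compatible.

End Product.

Section Lifts.
Context {R : realType} {n1 n2 : nat} (M1 : manifold R n1) (M2 : manifold R n2).
Local Notation M := (prod_manifold M1 M2).

Lemma atlas_differentiable n (N : manifold R n) (c : chart R n N) p :
  atlas c -> chart_dom c p ->
  differentiable (chart_map c \o chart_inv (chart_at p)) (chart_at p p).
Proof.
move=> ac cp; have [h _] := atlas_compatible (chart_at_atlas p) ac 1%N.
apply: h; split; first exact/chart_mapP/chart_at_dom.
by rewrite /= chart_mapK//; exact: chart_at_dom.
Qed.

Lemma field_derive_row_mx (V : forall p : M, tangent p) (c1 : chart R n1 M1)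
    (c2 : chart R n2 M2) (p : M) :
  atlas c1 -> atlas c2 -> chart_dom (prod_chart c1 c2) p ->
  field_derive V (chart_map (prod_chart c1 c2)) p =
  row_mx ('D_(lsubmx (V p : 'rV_(n1 + n2)))
            (c1 \o chart_inv (chart_at p.1)) (chart_at p.1 p.1))
         ('D_(rsubmx (V p : 'rV_(n1 + n2)))
            (c2 \o chart_inv (chart_at p.2)) (chart_at p.2 p.2)).
Proof.
move=> a1 a2 [p1 p2]; set F := c1 \o _; set G := c2 \o _; rewrite /field_derive.
have dF : differentiable F (chart_at p.1 p.1) by exact: atlas_differentiable.
have dG : differentiable G (chart_at p.2 p.2) by exact: atlas_differentiable.
have el : lsubmx (prod_chart_map (chart_at p.1) (chart_at p.2) p) = chart_at p.1 p.1.
  exact: row_mxKl.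
have er : rsubmx (prod_chart_map (chart_at p.1) (chart_at p.2) p) = chart_at p.2 p.2.
  exact: row_mxKr.
rewrite -[X in 'D__ X _]/(fun z : 'rV_(n1 + n2) =>
  row_mx ((F \o lsubmx) z) ((G \o rsubmx) z)).
rewrite derive_row_mx.
- by rewrite (derive_precomp lsubmx F) (derive_precomp rsubmx G) /= el er.
- apply: diff_derivable; apply: differentiable_comp.
    exact: differentiable_lsubmx.
  by rewrite /= el.
- apply: diff_derivable; apply: differentiable_comp.
    exact: differentiable_rsubmx.
  by rewrite /= er.
Qed.

Definition hlift_val (X : vector_field M1) (p : M) : tangent p :=
  row_mx (X p.1 : 'rV_n1) (0 : 'rV_n2).

Definition vlift_val (U : vector_field M2) (p : M) : tangent p :=
  row_mx (0 : 'rV_n1) (U p.2 : 'rV_n2).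

Lemma hlift_smooth (X : vector_field M1) c : @atlas _ _ M c ->
  smooth_on (chart_dom c) (field_derive (hlift_val X) (chart_map c)).
Proof.
move=> [[c1 c2] [/= a1 a2] <-] d [[d1 d2] [/= b1 b2] <-] k.
set U := _ `&` _.
have oU : open U.
  by apply: (@open_chart_preim _ _ _ (prod_chart d1 d2)); exact: prod_chart_dom_open.
pose A := field_derive X (chart_map c1).
have AU : Ck k U (fun z => row_mx (((A \o chart_inv d1) \o lsubmx) z)
                                  (cst (0 : 'rV_n2) z)).
  apply: Ck_row_mx => //; last exact: Ck_cst.
  apply: (Ck_subset _ (Ck_precomp (@continuous_lsubmx _ _ _ _)
    (vf_smooth X a1 b1 k))).
  by move=> z [[z1 z2] [w1 w2]].
apply: (Ck_eq oU) AU => z [rz dz]; rewrite [RHS]/comp.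
rewrite (field_derive_row_mx _ a1 a2 dz).
by rewrite /hlift_val row_mxKl row_mxKr derive0.
Qed.

Lemma vlift_smooth (U : vector_field M2) c : @atlas _ _ M c ->
  smooth_on (chart_dom c) (field_derive (vlift_val U) (chart_map c)).
Proof.
move=> [[c1 c2] [/= a1 a2] <-] d [[d1 d2] [/= b1 b2] <-] k.
set D := _ `&` _.
have oD : open D.
  by apply: (@open_chart_preim _ _ _ (prod_chart d1 d2)); exact: prod_chart_dom_open.
pose A := field_derive U (chart_map c2).
have AD : Ck k D (fun z => row_mx (cst (0 : 'rV_n1) z)
                                  (((A \o chart_inv d2) \o rsubmx) z)).
  apply: Ck_row_mx => //; first exact: Ck_cst.
  apply: (Ck_subset _ (Ck_precomp (@continuous_rsubmx _ _ _ _)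
    (vf_smooth U a2 b2 k))).
  by move=> z [[z1 z2] [w1 w2]].
apply: (Ck_eq oD) AD => z [rz dz]; rewrite [RHS]/comp.
rewrite (field_derive_row_mx _ a1 a2 dz).
by rewrite /vlift_val row_mxKl row_mxKr derive0.
Qed.

Definition horizontal_lift (X : vector_field M1) : vector_field M :=
  VectorField (hlift_smooth X).

Definition vertical_lift (U : vector_field M2) : vector_field M :=
  VectorField (vlift_smooth U).

End Lifts.

Definition path_in (R : realType) (T : topologicalType) (A : set T) (x y : T)
    (g : R -> T) : Prop :=
  [/\ {within `[0, 1], continuous g}, g @` `[0, 1] `<=` A, g 0 = x & g 1 = y].

Definition path_connected (R : realType) (T : topologicalType) (A : set T) :
    Prop :=
  A !=set0 /\ forall x y, A x -> A y -> exists g : R -> T, path_in A x y g.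

(** Every loop in [A] is homotopic in [A], relative to its endpoints, to a
    constant loop; in [H (s, t)], [s] is the loop parameter and [t] the time. *)
Definition simply_connected (R : realType) (T : topologicalType) (A : set T) :
    Prop :=
  path_connected R A /\
  forall (x : T) (g : R -> T), path_in A x x g ->
    exists H : R * R -> T,
      [/\ {within `[0, 1] `*` `[0, 1], continuous H},
          H @` (`[0, 1] `*` `[0, 1]) `<=` A,
          (forall s, 0 <= s <= 1 -> H (s, 0) = g s /\ H (s, 1) = x)
        & (forall t, 0 <= t <= 1 -> H (0, t) = x /\ H (1, t) = x)].

(** [metric_gram p] is the Gram matrix of the scalar product on the tangent
    space at [p] in the coordinates [chart_at p]. *)
Record pseudo_riemannian_metric (R : realType) (n : nat) (M : manifold R n) :=
  PseudoMetric {
    metric_gram :> M -> 'M[R]_n;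
    metric_sym : forall p, (metric_gram p)^T = metric_gram p;
    metric_nondegenerate : forall p, metric_gram p \in unitmx;
    metric_smooth : forall X Y : vector_field M,
      smooth_on setT (fun p => (X p *m metric_gram p *m (Y p)^T) 0 0 : R) }.

Record lyra_twisted_warped_product (R : realType) (n1 n2 : nat) :=
  LyraTwistedWarpedProduct {
    base : manifold R n1;
    fiber : manifold R n2;
    base_metric : pseudo_riemannian_metric base;
    fiber_metric : pseudo_riemannian_metric fiber;
    base_dim_gt0 : (0 < n1)%N;
    fiber_dim_gt0 : (0 < n2)%N;
    warping : prod_manifold base fiber -> R;
    lyra_scale : prod_manifold base fiber -> R;
    warping_smooth : smooth_on setT warping;
    lyra_scale_smooth : smooth_on setT lyra_scale;
    warping_gt0 : forall p, 0 < warping p;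
    lyra_scale_gt0 : forall p, 0 < lyra_scale p }.

Arguments warping {R n1 n2} l p.
Arguments lyra_scale {R n1 n2} l p.

Section Lyra.
Context {R : realType} {n1 n2 : nat} (L : lyra_twisted_warped_product R n1 n2).

Definition total_space : manifold R (n1 + n2) := prod_manifold (base L) (fiber L).

Definition twisted_metric (p : total_space) : 'M[R]_(n1 + n2) :=
  block_mx (base_metric L p.1) 0 0 (warping L p ^+ 2 *: fiber_metric L p.2).

Definition lyra_metric (p : total_space) : 'M[R]_(n1 + n2) :=
  lyra_scale L p ^+ 2 *: twisted_metric p.

Definition log_warping (p : total_space) : R := ln (warping L p).

Definition log_scale (p : total_space) : R := ln (lyra_scale L p).

Definition hfield (X : vector_field (base L)) : vector_field total_space :=
  horizontal_lift (fiber L) X.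

Definition vfield (U : vector_field (fiber L)) : vector_field total_space :=
  vertical_lift (base L) U.

(** [Ric(X, U) = 0], up to sign, for the Ricci tensor of [lyra_metric]. *)
Definition mixed_soliton_equation : Prop :=
  let k := log_warping in
  let sigma := log_scale in
  forall (X0 : vector_field (base L)) (U0 : vector_field (fiber L))
    (p : total_space),
    let X := field_derive (hfield X0) in
    let U := field_derive (vfield U0) in
    (n2%:R - 1) * X (U k) p +
    ((n1 + n2)%:R - 2) *
      (X (U sigma) p - X k p * U sigma p - X sigma p * U sigma p) = 0.

End Lyra.

Arguments log_warping {R n1 n2} L p.
Arguments log_scale {R n1 n2} L p.

(* Main.v *)
(** The lifts [X] and [U] commute and [X(sigma) = 0], so the mixed equation is
    [XU(k) - alpha X(k) U(sigma) = 0], that is [U(e^(-alpha sigma2) X(k)) = 0]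
    after multiplication by [e^(-alpha sigma2)].  Put
    [G = e^(-alpha sigma2) k]: then [UX(G) = 0] for all lifts.  Every tangent
    vector extends to a global vector field (cut off with a bump function), so
    the mixed second derivatives of [G] vanish in every product chart.  Hence
    the [x]-derivative of [G(., y)] is locally constant in [y], and in turn
    [G(., y) - G(., y')] is locally constant in [x]; on a path-connected product
    [G(x, y) = G(x, y0) + G(x0, y) - G(x0, y0)]. *)

From HB Require Import structures.
Require Import Defs.
From mathcomp Require Import all_boot all_order all_algebra.
From mathcomp Require Import all_classical all_reals all_analysis.
From mathcomp Require Import ring lra.
Import Order.TTheory GRing.Theory Num.Theory.
Import numFieldNormedType.Exports.
Local Open Scope classical_set_scope.
Local Open Scope ring_scope.
Set Implicit Arguments.
Unset Strict Implicit.
Unset Printing Implicit Defensive.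

(** * Smooth maps between normed spaces *)

Section SmoothMaps.
Context {R : realType}.
Implicit Types V W : normedModType R.

(** A second field derivative [Y (X h)] read in a chart also differentiates the components of [X].
    For lifts this extra term disappears: vertical motion leaves the base coordinates, hence the
    components of a horizontal lift, unchanged, and symmetrically. This is why [[X, U] = 0] and why
    mixed equations between fields become mixed partial derivatives in product charts. The equations
    quantify over global smooth fields, while the constancy argument needs arbitrary directions at
    each point. The cut-off extension must be smooth in every chart, including at points outside the
    domain of the chart in which it is built; there the Hausdorff property enters, by making a
    compact support closed. Since [Ck] is a recursion on directional derivatives, each closure
    property is an induction whose step writes ['D_v] of the new function through functions of lower
    class, on an open set where the formula is valid. *)

Lemma derivative_comp V V' W (f : V -> V') (g : V' -> W) x v :
  differentiable f x -> differentiable g (f x) ->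
  'D_v (g \o f) x = 'D_('D_v f x) g (f x).
Proof.
move=> df dg; rewrite (deriveE _ dg) (deriveE _ df).
by rewrite (deriveE _ (differentiable_comp df dg)) diff_comp.
Qed.

(** [Ck] is a condition at each point of its set, so it may be checked on a different set around
    each point. This glues the two formulas of a cut-off vector field. *)
Lemma Ck_local V W k (U : set V) (f : V -> W) :
  (forall x, U x -> exists2 U', U' x & Ck k U' f) -> Ck k U f.
Proof.
elim: k f => [|k IH] f /= h.
  by move=> x /h[U' U'x]; apply.
split=> [x /h[U' U'x []]|v]; first by move=> + _; apply.
by apply: IH => x /h[U' U'x [_ h2]]; exists U'.
Qed.

Lemma Ck_pred V W k (U : set V) (f : V -> W) : Ck k.+1 U f -> Ck k U f.
Proof.
elim: k f => [|k IH] f; first by case=> h _ x Ux; exact/differentiable_continuous/h.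
by case=> h1 h2; split=> // v; exact/IH/h2.
Qed.

Lemma smooth_differentiable V W (U : set V) (f : V -> W) x :
  smooth U f -> U x -> differentiable f x.
Proof. by move=> /(_ 1%N)[h _]; exact: h. Qed.

Lemma smooth_derive V W (U : set V) (f : V -> W) v :
  smooth U f -> smooth U ('D_v f).
Proof. by move=> h k; have [_] := h k.+1; exact. Qed.

Lemma CkN V W k (U : set V) (f : V -> W) :
  open U -> Ck k U f -> Ck k U (- f).
Proof.
move=> oU; elim: k f => [|k IH] f /=.
  by move=> h x Ux; apply: continuousN; exact: h.
move=> [h1 h2]; split=> [x Ux|v]; first by apply: differentiableN; exact: h1.
apply: (Ck_eq oU) (IH _ (h2 v)) => x Ux.
by rewrite deriveN//; apply: diff_derivable; exact: h1.
Qed.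

Lemma CkM V k (U : set V) (f g : V -> R) :
  open U -> Ck k U f -> Ck k U g -> Ck k U (f * g).
Proof.
move=> oU; elim: k f g => [|k IH] f g.
  by move=> hf hg x Ux; apply: continuousM; [exact: hf|exact: hg].
move=> fk gk; have f0 := Ck_pred fk; have g0 := Ck_pred gk.
case: fk gk => [f1 f2] [g1 g2]; split=> [x Ux|v].
  by apply: differentiableM; [exact: f1|exact: g1].
have := CkD oU (IH _ _ f0 (g2 v)) (IH _ _ g0 (f2 v)); apply: (Ck_eq oU) => x Ux.
by rewrite deriveM//; apply: diff_derivable; [exact: f1|exact: g1].
Qed.

Lemma Ck_sum V W k (U : set V) m (f : 'I_m -> V -> W) :
  open U -> (forall i, Ck k U (f i)) -> Ck k U (\sum_i f i).
Proof.
move=> oU h; elim/big_ind: _ => [|a b|i _]; last exact: h.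
- exact: (Ck_cst k U (0 : W)).
- exact: CkD.
Qed.

(* [l] are the coordinates of [W] in the basis [e]. *)
Lemma Ck_comp_basis V W k (U : set V) (U' : set W) (f : V -> W) (g : W -> R)
    m (e : 'I_m -> W) (l : 'I_m -> {linear W -> R}) :
  (forall i, continuous (l i)) -> (forall w, w = \sum_i l i w *: e i) ->
  open U -> (forall x, U x -> U' (f x)) -> Ck k U f -> Ck k U' g ->
  Ck k U (g \o f).
Proof.
move=> cl el oU UU' Uf; elim: k g Uf => [|k IH] g.
  by move=> hf hg x Ux; apply: continuous_comp; [exact: hf|exact/hg/UU'].
move=> fk [g1 g2]; have f0 := Ck_pred fk; have [f1 f2] := fk.
split=> [x Ux|v]; first by apply: differentiable_comp; [exact: f1|exact/g1/UU'].
(* In the chain rule the direction ['D_v f x] varies with [x], whereas the hypothesis on [g]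
   concerns fixed directions; expanding in the basis [e] leaves only the directions [e i]. *)
have h i : Ck k U ((l i \o 'D_v f) * ('D_(e i) g \o f)).
  apply: CkM => //; last exact: (IH _ f0 (g2 _)).
    exact: (Ck_postcomp oU (cl i) (f2 v)).
have := Ck_sum oU h; apply: (Ck_eq oU) => x Ux.
have dg : differentiable g (f x) by exact/g1/UU'.
rewrite derivative_comp//; last exact: f1.
rewrite [in RHS]deriveE// [in RHS](el ('D_v f x)) linear_sum fct_sumE.
apply: eq_bigr => i _; rewrite linearZ /= -deriveE//.
Qed.

Lemma Ck_comp_R V k (U : set V) (U' : set R) (f : V -> R) (g : R -> R) :
  open U -> (forall x, U x -> U' (f x)) -> Ck k U f -> Ck k U' g ->
  Ck k U (g \o f).
Proof.
apply: (@Ck_comp_basis V R k U U' f g 1 (fun=> 1) (fun=> idfun)) => [_ w|w].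
  exact: cvg_id.
by rewrite big_ord1 [RHS]mulr1.
Qed.

Definition coordinate m (i : 'I_m) : 'rV[R]_m -> R := fun w => w 0 i.

Lemma coordinate_linear m i : linear (@coordinate m i).
Proof. by move=> a u v; rewrite /coordinate !mxE. Qed.

HB.instance Definition _ m i :=
  GRing.isLinear.Build R _ _ _ _ (@coordinate_linear m i).

Lemma Ck_comp_rV V m k (U : set V) (U' : set 'rV[R]_m) (f : V -> 'rV[R]_m)
    (g : 'rV[R]_m -> R) :
  open U -> (forall x, U x -> U' (f x)) -> Ck k U f -> Ck k U' g ->
  Ck k U (g \o f).
Proof.
apply: (@Ck_comp_basis V _ k U U' f g m (delta_mx 0) (@coordinate m)).
- by move=> i w; exact: coord_continuous.
- exact: row_sum_delta.
Qed.

Lemma Ck_coord V m k (U : set V) (f : V -> 'rV[R]_m) i :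
  open U -> Ck k U f -> Ck k U (fun x => f x 0 i).
Proof.
move=> oU; apply: (@Ck_postcomp _ _ _ _ _ U (coordinate i)) => //.
by move=> w; exact: coord_continuous.
Qed.

Definition scale_vector W (w : W) : R -> W := fun a => a *: w.

Lemma scale_vector_linear W (w : W) : linear (scale_vector w).
Proof. by move=> a u v; rewrite /scale_vector scalerDl scalerA. Qed.

HB.instance Definition _ W (w : W) :=
  GRing.isLinear.Build R _ _ _ _ (@scale_vector_linear W w).

Lemma Ck_rV V m k (U : set V) (f : V -> 'rV[R]_m) :
  open U -> (forall i, Ck k U (fun x => f x 0 i)) -> Ck k U f.
Proof.
move=> oU h.
have -> : f = \sum_i (scale_vector (delta_mx 0 i : 'rV[R]_m) \o (fun x => f x 0 i)).
  by apply/funext => x; rewrite [LHS]row_sum_delta fct_sumE.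
apply: Ck_sum => // i; apply: (Ck_postcomp oU _ (h i)); exact: scalel_continuous.
Qed.

Lemma Ck_comp V m m' k (U : set V) (U' : set 'rV[R]_m) (f : V -> 'rV[R]_m)
    (g : 'rV[R]_m -> 'rV[R]_m') :
  open U -> open U' -> (forall x, U x -> U' (f x)) -> Ck k U f -> Ck k U' g ->
  Ck k U (g \o f).
Proof.
move=> oU oU' UU' Uf Ug; apply: Ck_rV => // i.
by apply: (Ck_comp_rV oU UU' Uf (g := fun w => g w 0 i)); exact: Ck_coord.
Qed.

Lemma derive_scale_R (g : R -> R) x v :
  differentiable g x -> 'D_v g x = v * 'D_1 g x.
Proof.
by move=> dg; rewrite !deriveE// -[in LHS](mulr1 v) -[v * 1]/(v *: 1) linearZ.
Qed.

Lemma Ck_expR k : Ck k setT (@expR R).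
Proof.
have de (x : R) : differentiable expR x by exact/derivable1_diffP/derivable_expR.
elim: k => [x _|k IH]; first exact: continuous_expR.
split=> [x _ //|v]; have := CkM openT (Ck_cst k setT (v : R)) IH.
by apply: (Ck_eq openT) => x _; rewrite derive_scale_R// derive_val.
Qed.

Lemma open_gt0 : open [set x : R | 0 < x].
Proof. exact: open_gt. Qed.

(** The derivative of [x^-1] in direction [v] is [- v * (x^-1 * x^-1)], so the inverse function
    reproduces itself through products and the induction closes. *)
Lemma Ck_inv k : Ck k [set x : R | 0 < x] (@GRing.inv R).
Proof.
have dV (x : R) : 0 < x -> differentiable (@GRing.inv R) x.
  by move=> x0; apply: differentiable_Rinv; rewrite gt_eqF.
elim: k => [x /= x0|k IH]; first exact/differentiable_continuous/dV.
split=> [x /= /dV//|v].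
have := CkM open_gt0 (Ck_cst k _ (- v : R)) (CkM open_gt0 IH IH).
apply: (Ck_eq open_gt0) => x /= x0.
rewrite deriveE; last exact: dV.
by rewrite diff_Rinv ?gt_eqF// !fctE /GRing.scale/= expr2 invfM; lra.
Qed.

Lemma Ck_ln k : Ck k [set x : R | 0 < x] (@ln R).
Proof.
have dln (x : R) : 0 < x -> differentiable (@ln R) x.
  by move=> x0; apply/derivable1_diffP; have [] := is_derive1_ln x0.
case: k => [x /= x0|k]; first exact/differentiable_continuous/dln.
split=> [x /= /dln//|v].
have := CkM open_gt0 (Ck_cst k _ (v : R)) (Ck_inv k).
apply: (Ck_eq open_gt0) => x /= x0.
rewrite (derive_scale_R _ (dln _ x0)).
by have [_ ->] := is_derive1_ln x0.
Qed.

End SmoothMaps.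

(** * Bump functions *)

Section Bump.
Context {R : realType}.

(* [x^-m e^(-1/x)], extended by [0] to [x <= 0]; the family is closed under
   differentiation up to linear combinations. *)
Definition flat m (x : R) : R :=
  if 0 < x then x^-1 ^+ m * expR (- x^-1) else 0.

(** With [u = x^-1], one term of the exponential series gives [u ^+ m.+2 <= (m.+2)! * e^u], hence
    [u ^+ m * e^(-u) <= (m.+2)! * u^-2]. Order two is what makes the difference quotient at [0]
    vanish. *)
Lemma flat_le_sqr m (x : R) : `|flat m x| <= (m.+2)`!%:R * x ^+ 2.
Proof.
rewrite /flat; case: ltP => x0; last first.
  by rewrite normr0 mulr_ge0// sqr_ge0.
have xV0 : 0 < x^-1 by rewrite invr_gt0.
rewrite ger0_norm; last by rewrite mulr_ge0// ?expR_ge0// exprn_ge0// ltW.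
have := @expR_ge1Dxn _ x^-1 m.+1 (ltW xV0); set F := _`!%:R => h.
have F0 : 0 < F :> R by rewrite ltr0n fact_gt0.
have {}h : x^-1 ^+ m.+2 <= F * expR x^-1.
  rewrite mulrC -ler_pdivrMr//; by apply: le_trans h; rewrite lerDr.
rewrite expRN ler_pdivrMr ?expR_gt0//.
rewrite -(@ler_pM2l _ (x^-1 ^+ 2)) ?exprn_gt0//.
rewrite -exprD add2n (le_trans h)// mulrA mulrCA -exprMn mulVf ?gt_eqF//.
by rewrite expr1n mulr1.
Qed.

Lemma is_derive_flat m (x : R) :
  is_derive x 1 (flat m) (- m%:R * flat m.+1 x + flat m.+2 x).
Proof.
have [x0|x0|<-] := ltgtP 0 x.
- apply: (@near_eq_is_derive _ _ _
    ((fun y : R => y^-1) ^+ m * (expR \o (- (fun y : R => y^-1))))).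
    apply: filterS (open_nbhs_nbhs (conj (@open_gt0 R) x0)) => y /= y0.
    by rewrite /flat y0 exprfctE.
  have dV : is_derive x 1 (fun y : R => y^-1) (- x ^- 2).
    apply: is_derive_eq; first by apply: is_deriveV; rewrite gt_eqF.
    by rewrite scaler1.
  have dE : is_derive x 1 (expR \o (- (fun y : R => y^-1)))
      (x ^- 2 * expR (- x^-1)).
    have -> : x ^- 2 * expR (- x^-1) = expR (- x^-1) * - - x ^- 2.
      by rewrite opprK mulrC.
    have dN : is_derive x 1 (- (fun y : R => y^-1)) (- - x ^- 2).
      exact: is_deriveN.
    exact: (@is_derive1_comp R expR _ x _ _ (is_derive_expR _) dN).
  apply: is_derive_eq.
  rewrite /flat x0 !fctE /GRing.scale/=.
  have -> : x ^- 2 = x^-1 ^+ 2 by rewrite exprVn.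
  (* The power rule produces the exponent [m.-1], hence the separate case [m = 0]. *)
  case: m => [|m]; first by rewrite !expr0 expr1 /=; ring.
  by rewrite /= !exprS; ring.
- apply: (@near_eq_is_derive _ _ _ (cst 0)).
    apply: filterS (open_nbhs_nbhs (conj (@open_lt R 0) x0)) => y /= y0.
    by rewrite /flat ltNge (ltW y0).
  apply: is_derive_eq.
  by rewrite /flat ltNge (ltW x0)/= mulr0 addr0.
- rewrite /flat ltxx mulr0 addr0.
  (* At the origin the difference quotient is bounded by [(m.+2)! * |h|]. *)
  have h : (fun h : R => h^-1 *: ((flat m \o shift 0) (h *: 1) - flat m 0)) @ 0^'
      --> (0 : R).
    apply/cvgrPdist_le => /= e e0.
    have C0 : 0 < (m.+2)`!%:R :> R by rewrite ltr0n fact_gt0.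
    near=> h.
    have h0 : h != 0 by near: h; exact: nbhs_dnbhs_neq.
    rewrite sub0r normrN /flat ltxx subr0 /= addr0.
    rewrite -/(flat m (h *: 1)) [h *: 1]mulr1 normrM normfV.
    rewrite ler_pdivrMl ?normr_gt0//.
    apply: (le_trans (flat_le_sqr _ _)).
    rewrite -(real_normK (num_real h)) expr2 mulrCA.
    rewrite ler_pM2l ?normr_gt0// mulrC -ler_pdivlMr//; near: h.
    apply: dnbhs0_le; exact: divr_gt0.
  by split; [apply/cvg_ex; exists 0|exact/cvg_lim].
Unshelve. all: by end_near. Qed.

Lemma Ck_flat m k : Ck k setT (flat m).
Proof.
have df j (x : R) : differentiable (flat j) x.
  by apply/derivable1_diffP; have [] := is_derive_flat j x.
elim: k m => [|k IH] m; first by move=> x _; exact/differentiable_continuous.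
split=> [//|v].
have := CkM openT (Ck_cst k setT (v : R))
  (CkD openT (CkM openT (Ck_cst k setT (- m%:R : R)) (IH m.+1)) (IH m.+2)).
apply: (Ck_eq openT) => x _.
rewrite (derive_scale_R _ (df m x)).
by have [_ ->] := is_derive_flat m x.
Qed.

Lemma Ck_id (V : normedModType R) k (U : set V) : Ck k U (@id V).
Proof.
case: k => [|k]; first by move=> x _; exact: cvg_id.
split=> [x _|v]; first by have [] := is_diff_id x.
by rewrite (_ : 'D_v _ = cst v)//; [exact: Ck_cst|apply/funext => x; exact: derive_id].
Qed.

(** The norm of row vectors is the maximum norm, in general not smooth, so the cut-off is a function
    of [r^2] minus the squared Euclidean distance to [a]. The Euclidean ball lies inside the
    max-norm ball of the same radius, which bounds the set where [b] is nonzero. *)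
Lemma bump_function n (a : 'rV[R]_n) (r : R) : 0 < r ->
  exists b : 'rV[R]_n -> R,
    [/\ smooth setT b, b a = 1 & forall z, b z != 0 -> `|z - a| <= r].
Proof.
move=> r0.
pose q : 'rV[R]_n -> R :=
  cst (r ^+ 2) - \sum_i (fun z : 'rV_n => z 0 i - a 0 i) * (fun z => z 0 i - a 0 i).
have qE z : q z = r ^+ 2 - \sum_i (z 0 i - a 0 i) ^+ 2.
  by rewrite /q !fctE fct_sumE; congr (_ - _); apply: eq_bigr => i _; rewrite expr2.
have Ckq k : Ck k setT q.
  apply: CkD; first exact: openT.
    exact: Ck_cst.
  apply: CkN; first exact: openT.
  apply: Ck_sum; first exact: openT.
  move=> i; have h : Ck k setT ((fun z : 'rV[R]_n => z 0 i) + cst (- a 0 i)).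
    apply: CkD; [exact: openT| |exact: Ck_cst].
    by apply: (Ck_coord i openT); exact: Ck_id.
  by apply: CkM => //; exact: openT.
have qa : q a = r ^+ 2.
  by rewrite qE big1 ?subr0// => i _; rewrite subrr expr0n.
have f0 : 0 < flat 0 (r ^+ 2) :> R.
  by rewrite /flat exprn_gt0// expr0 mul1r expR_gt0.
exists (cst (flat 0 (r ^+ 2))^-1 * (flat 0 \o q)); split.
- move=> k; apply: CkM; [exact: openT|exact: Ck_cst|].
  by apply: (Ck_comp_R openT (fun _ _ => I) (Ckq k)); exact: Ck_flat.
- by rewrite !fctE /= qa mulVf// gt_eqF.
- move=> z; rewrite !fctE /= mulf_eq0 negb_or => /andP[_].
  rewrite {1}/flat; case: ltP; last by rewrite eqxx.
  rewrite qE subr_gt0 => h _.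
  rewrite [leLHS]/Num.Def.normr/= mx_normrE (bigmax_le _ (ltW r0))//= => -[i j] _.
  rewrite !mxE /= (ord1 i) -ler_sqr ?nnegrE ?(ltW r0)// real_normK ?num_real//.
  apply/ltW/(le_lt_trans _ h); rewrite (bigD1 j)//= lerDl.
  by apply: sumr_ge0 => k _; exact: sqr_ge0.
Qed.

End Bump.

(** * Mean value theorem and symmetry of second derivatives *)

Section MeanValue.
Context {R : realType}.
Implicit Types V W : normedModType R.

Lemma is_derive_line V W (f : V -> W) (v x : V) (t : R) :
  differentiable f (t *: v + x) ->
  is_derive t 1 (fun s : R => f (s *: v + x)) ('D_v f (t *: v + x)).
Proof.
move=> df; pose a : R -> V := fun s => s *: v + x.
have da : is_diff t a (fun s => s *: v + 0) by exact: is_diffD.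
have dfa : differentiable (f \o a) t by apply: differentiable_comp => //; case: da.
split; first exact/(@diff_derivable _ _ _ (f \o a)).
have [ca _] := da.
rewrite -[fun s : R => _]/(f \o a) (derivative_comp _ ca df).
congr ('D_ _ f _); rewrite (deriveE _ ca) (@diff_val _ _ _ _ _ _ _ da).
by rewrite scale1r addr0.
Qed.

Lemma line_mean_value V (f : V -> R) (v x : V) (h : R) : 0 < h ->
  (forall t : R, 0 <= t <= h -> differentiable f (t *: v + x)) ->
  exists2 t, 0 <= t <= h & f (h *: v + x) - f x = h * 'D_v f (t *: v + x).
Proof.
move=> h0 df.
have [|||t] := @MVT_segment R (fun s => f (s *: v + x))
  (fun s => 'D_v f (s *: v + x)) 0 h.
- exact: ltW.
- by move=> t; rewrite in_itv/= => /andP[t0 th]; apply/is_derive_line/df; rewrite !ltW.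
- apply: derivable_within_continuous => t; rewrite in_itv/= => th.
  by have [] := is_derive_line (df _ th).
rewrite in_itv/= scale0r add0r subr0 mulrC => th ->; by exists t.
Qed.

(** Mean value theorem twice: along [w] for the increment [g y = f (y + h *: v) - f y], then along
    [v] for ['D_w f]. The left side is symmetric in [v] and [w], which is the source of
    [derive_comm]. *)
Lemma second_difference V (U : set V) (f : V -> R) (v w x : V) (h : R) :
  0 < h -> Ck 2 U f ->
  (forall s t : R, 0 <= s <= h -> 0 <= t <= h -> U (s *: v + (t *: w + x))) ->
  exists s t, [/\ 0 <= s <= h, 0 <= t <= h &
    f (h *: v + (h *: w + x)) - f (h *: v + x) - (f (h *: w + x) - f x) =
    h * (h * 'D_v ('D_w f) (s *: v + (t *: w + x)))].
Proof.
move=> h0 [f1 f2] hU.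
have hh : 0 <= h <= h by rewrite lexx ltW.
have zh : (0 : R) <= 0 <= h by rewrite lexx ltW.
pose g y := f (y + h *: v) - f y.
have dg1 t : 0 <= t <= h -> differentiable f (t *: w + x + h *: v).
  by move=> th; apply: f1; rewrite addrC; exact: hU.
have dg0 t : 0 <= t <= h -> differentiable f (t *: w + x).
  by move=> th; apply: f1; rewrite -[_ + x]add0r -(scale0r v); exact: hU.
have shE : shift (h *: v) = @id V + cst (h *: v) by [].
have dsh (y : V) : is_diff y (shift (h *: v)) id.
  by rewrite shE; apply: is_diff_eq; rewrite addr0.
have dfs t : 0 <= t <= h -> differentiable (f \o shift (h *: v)) (t *: w + x).
  move=> th; apply: differentiable_comp; last exact: dg1.
  by have [] := dsh (t *: w + x).
have [|t th] := @line_mean_value V g w x h h0.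
  by move=> t th; apply: differentiableB; [exact: dfs|exact: dg0].
have -> : 'D_w g (t *: w + x) =
    'D_w f (h *: v + (t *: w + x)) - 'D_w f (t *: w + x).
  rewrite [LHS](@deriveB _ _ _ (f \o shift (h *: v)) f); last 2 first.
  - exact/diff_derivable/dfs.
  - exact/diff_derivable/dg0.
  congr (_ - _); rewrite derivative_comp; last 2 first.
  - by have [] := dsh (t *: w + x).
  - exact: dg1.
  rewrite (deriveE w (f := shift (h *: v))); last by have [] := dsh (t *: w + x).
  by rewrite (@diff_val _ _ _ _ _ _ _ (dsh _)) /shift /= addrC.
have [|s sh ->] := @line_mean_value V ('D_w f) v (t *: w + x) h h0.
  by move=> s sh; have [+ _] := f2 w; apply; exact: hU.
by move=> gE; exists s, t; split=> //; rewrite -gE /g ![_ + h *: v]addrC; ring.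
Qed.

Lemma near_open_cvg2 V (U : set V) (f g : V -> R) (x : V) (e : R) :
  open U -> U x -> {for x, continuous f} -> {for x, continuous g} -> 0 < e ->
  \forall y \near x, [/\ U y, `|f x - f y| <= e & `|g x - g y| <= e].
Proof.
move=> oU Ux cf cg e0.
have nU := open_nbhs_nbhs (conj oU Ux).
have /cvgrPdist_le/(_ _ e0) nf := cf.
have /cvgrPdist_le/(_ _ e0) ng := cg.
by near=> y; split; near: y.
Unshelve. all: by end_near. Qed.

Lemma dist_triangle_half (a b c c' e : R) :
  `|a - c| <= e / 2 -> `|b - c'| <= e / 2 -> c = c' -> `|a - b| <= e.
Proof.
move=> ac bc cc'; rewrite -cc' distrC in bc.
by rewrite -(subrKA c) (splitr e) (le_trans (ler_normD _ _))// lerD.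
Qed.

(** Schwarz's theorem: the same second difference equals [h^2] times either mixed derivative, each
    at some point of a small parallelogram at [x]; continuity of both derivatives brings these
    values within [e / 2] of those at [x]. *)
Lemma derive_comm V (U : set V) (f : V -> R) (v w x : V) :
  open U -> Ck 2 U f -> U x -> 'D_v ('D_w f) x = 'D_w ('D_v f) x.
Proof.
move=> oU Uf Ux; have [f1 f2] := Uf.
have cf a b : {for x, continuous ('D_a ('D_b f))}.
  by have [_ +] := f2 b; move=> /(_ a); exact.
apply/eqP; rewrite -subr_eq0 -normr_eq0 eq_le normr_ge0 andbT.
apply/ler_addgt0Pl => e e0; rewrite addr0.
have e20 : 0 < e / 2 by rewrite divr_gt0.
have : \forall y \near x, [/\ U y,
    `|'D_v ('D_w f) x - 'D_v ('D_w f) y| <= e / 2 &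
    `|'D_w ('D_v f) x - 'D_w ('D_v f) y| <= e / 2].
  exact: (@near_open_cvg2 V U ('D_v ('D_w f)) ('D_w ('D_v f)) x (e / 2)
    oU Ux (cf v w) (cf w v) e20).
move=> /nbhs_normP[d /= d0 hd].
(* With this [h] every point of the parallelogram is at distance at most
   [h * (|v| + |w| + 1) = d / 2] from [x]; the summand [1] keeps the denominator positive when
   [v = w = 0]. *)
pose h := d / (2 * (`|v| + `|w| + 1)).
have K0 : 0 < `|v| + `|w| + 1 by rewrite ltr_wpDl// addr_ge0.
have h0 : 0 < h by rewrite divr_gt0// mulr_gt0.
have small s t : 0 <= s <= h -> 0 <= t <= h ->
    `|x - (s *: v + (t *: w + x))| < d.
  move=> /andP[s0 sh] /andP[t0 th].
  rewrite addrA opprD addrCA subrr addr0 normrN.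
  apply: (le_lt_trans (ler_normD _ _)); rewrite !normrZ !ger0_norm//.
  apply: (@le_lt_trans _ _ (h * (`|v| + `|w| + 1))).
    rewrite !mulrDr mulr1; apply: ler_wpDr; first exact: ltW.
    by apply: lerD; apply: ler_wpM2r.
  rewrite /h invfM mulrA mulfVK ?gt_eqF//; lra.
have hU s t : 0 <= s <= h -> 0 <= t <= h -> U (s *: v + (t *: w + x)).
  by move=> sh th; have [] := hd _ (small s t sh th).
have hU' t s : 0 <= t <= h -> 0 <= s <= h -> U (t *: w + (s *: v + x)).
  by move=> th sh; rewrite addrCA; exact: hU.
have [s [t [sh th E1]]] := second_difference h0 Uf hU.
have [t' [s' [th' sh' E2]]] := second_difference h0 Uf hU'.
have [_ A1 _] := hd _ (small _ _ sh th).
have [_ _ B1] := hd _ (small _ _ sh' th').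
rewrite addrCA in B1.
have E : 'D_v ('D_w f) (s *: v + (t *: w + x)) =
    'D_w ('D_v f) (t' *: w + (s' *: v + x)).
  have hn0 : h != 0 by rewrite gt_eqF.
  apply: (mulfI hn0); apply: (mulfI hn0).
  refine (etrans (esym E1) (etrans _ E2)); move=> {E1 E2}.
  have swap (a b c c' : R) : a - b - (c - c') = a - c - (b - c') by ring.
  by rewrite [h *: w + (h *: v + x)]addrCA swap.
exact: (dist_triangle_half A1 B1 E).
Qed.

(** The level set of the value [h x] is relatively clopen in [A]: it is the trace of the interior of
    that level set, and also of the complement of the interior of [h <> h x]. *)
Lemma locally_constant_connected (T : topologicalType) (A : set T) (h : T -> R) :
  connected A -> (forall q, A q -> \forall p \near q, h p = h q) ->
  forall x y, A x -> A y -> h x = h y.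
Proof.
move=> cA hA x y Ax Ay.
suff /seteqP[_ /(_ y Ay)[_ /= ->//]] : A `&` [set q | h q = h x] = A.
apply: cA; first by exists x.
- exists ([set q | h q = h x])°; first exact: open_interior.
  apply/seteqP; split=> q [Aq hq]; split=> //; last exact: (interior_subset hq).
  by apply: filterS (hA q Aq) => p /= ->.
- exists (~` ([set q | h q <> h x])°); first exact/open_closedC/open_interior.
  apply/seteqP; split=> q [Aq hq]; split=> //.
    by move=> /interior_subset; apply.
  apply: contrapT => nhq; apply: hq.
  by apply: filterS (hA q Aq) => p /= ->.
Qed.

End MeanValue.

(** Balls in a chart are convex, so the mean value theorem along a segment gives local constancy,
    and the connected image of a path in [W] propagates it. Only pointwise differentiability is
    asked of [h], because the lemma is applied both to differences of slices and to directional
    derivatives of slices. *)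
Lemma zero_derivative_constant (R : realType) n (M : manifold R n) (W : set M)
    (h : M -> R) : open W -> path_connected R W ->
  (forall c q, atlas c -> chart_dom c q -> W q ->
    differentiable (h \o chart_inv c) (c q) /\
    forall v, 'D_v (h \o chart_inv c) (c q) = 0) ->
  forall x y, W x -> W y -> h x = h y.
Proof.
move=> oW [_ pW] h0 x y Wx Wy.
have loc q : W q -> \forall p \near q, h p = h q.
  move=> Wq; pose c := chart_at q.
  have cq : chart_dom c q by exact: chart_at_dom.
  have : nbhs (c q) (chart_ran c `&` chart_inv c @^-1` W).
    apply: open_nbhs_nbhs; split; first exact: (open_chart_preim oW).
    by split; [exact: chart_mapP|rewrite /preimage/= chart_mapK].
  move=> /nbhs_normP[d /= d0 hd].
  near=> p.
  have cp : chart_dom c p.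
    by near: p; exact: open_nbhs_nbhs (conj (@chart_dom_open _ _ _ c) cq).
  have pd : `|c q - c p| < d.
    by near: p; have /cvgrPdist_lt := chart_map_continuous cq; exact.
  have small t : 0 <= t <= 1 -> `|c q - (t *: (c p - c q) + c q)| < d.
    move=> /andP[t0 t1]; rewrite opprD addrCA subrr addr0 normrN normrZ ger0_norm//.
    by rewrite distrC (le_lt_trans _ pd)// ler_piMl.
  have hz z : `|c q - z| < d -> differentiable (h \o chart_inv c) z /\
      forall v, 'D_v (h \o chart_inv c) z = 0.
    move=> /hd[cz Wz]; rewrite -(chart_invK cz); apply: h0 => //.
      exact: chart_at_atlas.
    exact: chart_invP.
  have [||t th] := @line_mean_value R _ (h \o chart_inv c) (c p - c q) (c q) 1.
  - exact: ltr01.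
  - by move=> t th; have [] := hz _ (small t th).
  have [_ ->] := hz _ (small t th).
  rewrite scale1r subrK /= !chart_mapK// mulr0 => /eqP.
  by rewrite subr_eq0 => /eqP.
have [g [cg gW g0 g1]] := pW _ _ Wx Wy.
apply: (@locally_constant_connected R _ (g @` `[0, 1]) h).
- by apply: connected_continuous_connected => //; exact: segment_connected.
- by move=> q /gW/loc.
- by exists 0 => //; rewrite /= in_itv/= lexx ler01.
- by exists 1 => //; rewrite /= in_itv/= lexx ler01.
Unshelve. all: by end_near. Qed.

(** * Vector fields in charts *)

Section DirectionalDerivatives.
Context {R : realType}.
Implicit Types V W : normedModType R.

Lemma derive_dirZ V W (f : V -> W) x (s : R) v :
  differentiable f x -> 'D_(s *: v) f x = s *: 'D_v f x.
Proof. by move=> df; rewrite (deriveE _ df) (deriveE _ df) linearZ. Qed.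

Lemma derive_dir_sum m (f : 'rV[R]_m -> R) x v :
  differentiable f x -> 'D_v f x = \sum_i v 0 i * 'D_(delta_mx 0 i) f x.
Proof.
move=> df; rewrite [in LHS](deriveE _ df) [in LHS](row_sum_delta v) linear_sum.
by apply: eq_bigr => i _; rewrite linearZ /= (deriveE _ df).
Qed.

(** A directional derivative sees only the line through [x] along [v]. Agreement on that line is all
    that is available when the components of a field are constant in one direction only. *)
Lemma line_eq_derive V W (f g : V -> W) x v :
  (\forall t \near (0 : R), f (t *: v + x) = g (t *: v + x)) ->
  'D_v f x = 'D_v g x.
Proof.
move=> fg; have fgx : f x = g x.
  by have := nbhs_singleton fg; rewrite scale0r add0r.
rewrite /derive; congr (lim _); rewrite eqEsubset.
split; apply/near_eq_cvg/cvg_within; apply: filterS fg => t /= e.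
  by rewrite e fgx.
by rewrite e fgx.
Qed.

End DirectionalDerivatives.

Section VectorFields.
Context {R : realType} {n : nat} (M : manifold R n).
Implicit Types c d : chart R n M.

Lemma chart_ranI c (A : set M) q : chart_dom c q -> A q ->
  (chart_ran c `&` chart_inv c @^-1` A) (c q).
Proof. by move=> cq Aq; split; [exact: chart_mapP|rewrite /preimage/= chart_mapK]. Qed.

Lemma near_chart c (A : set M) q : open A -> chart_dom c q -> A q ->
  \forall z \near c q, chart_ran c z /\ A (chart_inv c z).
Proof.
move=> oA cq Aq.
have : nbhs (c q) (chart_ran c `&` chart_inv c @^-1` A).
  apply: open_nbhs_nbhs; split; [exact: open_chart_preim|exact: chart_ranI].
by [].
Qed.

Lemma near_line_chart c q (v : 'rV[R]_n) : chart_dom c q ->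
  \forall t \near (0 : R), chart_ran c (t *: v + c q).
Proof.
move=> cq; have : continuous ((fun t : R => t *: v) + cst (c q)).
  move=> t; apply: continuousD; last exact: cst_continuous.
  exact: scalel_continuous.
move=> /(_ 0); apply; rewrite /= !fctE scale0r add0r.
by apply: open_nbhs_nbhs; split; [exact: chart_ran_open|exact: chart_mapP].
Qed.

Lemma transition_differentiable c d q : atlas c -> atlas d ->
  chart_dom c q -> chart_dom d q -> differentiable (d \o chart_inv c) (c q).
Proof.
move=> ac ad cq dq; apply: (smooth_differentiable (atlas_compatible ac ad)).
exact: chart_ranI.
Qed.

Lemma derive_transition (W : normedModType R) (h : M -> W) c d q v :
  atlas c -> atlas d -> chart_dom c q -> chart_dom d q ->
  differentiable (h \o chart_inv d) (d q) ->
  'D_v (h \o chart_inv c) (c q) =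
  'D_('D_v (d \o chart_inv c) (c q)) (h \o chart_inv d) (d q).
Proof.
move=> ac ad cq dq dh.
have e : (d \o chart_inv c) (c q) = d q by rewrite /= chart_mapK.
rewrite -[in RHS]e -derivative_comp; last 2 first.
- exact: transition_differentiable.
- by rewrite e.
apply: near_eq_derive.
apply: filterS (near_chart (@chart_dom_open _ _ _ d) cq dq) => z [_ dz] /=.
by rewrite (chart_mapK dz).
Qed.

Lemma field_derive_chart (W : normedModType R) (X : forall p : M, tangent p)
    (h : M -> W) c q : atlas c -> chart_dom c q ->
  differentiable (h \o chart_inv c) (c q) ->
  field_derive X h q = 'D_(field_derive X c q) (h \o chart_inv c) (c q).
Proof.
move=> ac cq dh; apply: derive_transition => //; first exact: chart_at_atlas.
exact: chart_at_dom.
Qed.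

Lemma smooth_on_differentiable (W : normedModType R) (A : set M) (h : M -> W) c q :
  smooth_on A h -> atlas c -> chart_dom c q -> A q ->
  differentiable (h \o chart_inv c) (c q).
Proof.
move=> sh ac cq Aq; apply: (smooth_differentiable (sh c ac)).
exact: chart_ranI.
Qed.

Lemma smooth_on_chart (W : normedModType R) (h : M -> W) c :
  smooth_on setT h -> atlas c -> smooth (chart_ran c) (h \o chart_inv c).
Proof. by move=> sh ac; apply: smooth_subset (sh c ac) => z. Qed.

(** In a chart [X h] is the sum over [i] of the component [X^i] times the [i]-th partial derivative
    of [h]. *)
Lemma smooth_on_field_derive (X : vector_field M) (h : M -> R) :
  smooth_on setT h -> smooth_on setT (field_derive X h).
Proof.
move=> sh c ac; apply: (@smooth_subset _ _ _ (chart_ran c)) => [z []//|k].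
have oc := @chart_ran_open _ _ _ c.
have hc := smooth_on_chart sh ac.
have Xc : Ck k (chart_ran c) (field_derive X c \o chart_inv c).
  by apply: (Ck_subset _ (vf_smooth X ac ac k)) => z cz; split=> //; exact: chart_invP.
have : Ck k (chart_ran c) (\sum_i (fun z => (field_derive X c \o chart_inv c) z 0 i) *
    'D_(delta_mx 0 i) (h \o chart_inv c)).
  apply: Ck_sum => // i; apply: CkM => //; first exact: Ck_coord.
  exact: (smooth_derive (delta_mx 0 i) hc).
apply: (Ck_eq oc) => z cz; rewrite fct_sumE [RHS]/comp.
have dz := chart_invP cz.
have dh : differentiable (h \o chart_inv c) z by exact: smooth_differentiable hc cz.
have e : c (chart_inv c z) = z by exact: chart_invK.
by rewrite (field_derive_chart _ ac dz) e// (derive_dir_sum _ dh).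
Qed.

(** In general [Y (X h)] contains the first-order term [Y(X^i) * d_i h]. Constancy of the components
    of [X] along the line through [q] in the direction of [Y] removes it. *)
Lemma field_derive2_chart (X Y : vector_field M) (h : M -> R) c q :
  smooth_on setT h -> atlas c -> chart_dom c q ->
  (\forall t \near (0 : R),
    field_derive X c (chart_inv c (t *: field_derive Y c q + c q)) =
    field_derive X c q) ->
  field_derive Y (field_derive X h) q =
  'D_(field_derive Y c q) ('D_(field_derive X c q) (h \o chart_inv c)) (c q).
Proof.
move=> sh ac cq Xq.
rewrite (field_derive_chart _ ac cq); last first.
  exact: (smooth_on_differentiable (smooth_on_field_derive X sh)).
apply: line_eq_derive.
have ct := near_line_chart (field_derive Y c q) cq.
near=> t.
have ctt : chart_ran c (t *: field_derive Y c q + c q) by near: t.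
have Xt : field_derive X c (chart_inv c (t *: field_derive Y c q + c q)) =
    field_derive X c q by near: t.
have dt := chart_invP ctt.
have e := chart_invK ctt.
have dh := smooth_on_differentiable sh ac dt I.
rewrite [LHS]/comp (field_derive_chart X ac dt dh) e.
by congr ('D_ _ _ _).
Unshelve. all: by end_near. Qed.

(** In a Hausdorff manifold this makes the coordinate ball closed in all of [M], not merely in the
    chart domain, so that its complement is an open set on which a cut-off field is zero. *)
Lemma compact_chart_ball c (a : 'rV[R]_n) (r : R) :
  0 < r -> (forall z, `|z - a| <= r -> chart_ran c z) ->
  compact (chart_inv c @` [set z | `|z - a| <= r]).
Proof.
move=> r0 ball_ran; apply: continuous_compact.
  apply: continuous_in_subspaceT => z; rewrite inE /= => za.
  exact/chart_inv_continuous/ball_ran.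
apply: bounded_closed_compact.
  exists (`|a| + r); split; first exact: num_real.
  move=> x xar z /= za; apply/ltW/(le_lt_trans _ xar).
  by rewrite -[z](subrK a) addrC (le_trans (ler_normD _ _))// lerD2l.
have -> : [set z | `|z - a| <= r] = closed_ball a r.
  by rewrite closed_ballE//; apply/seteqP; split=> z; rewrite /closed_ball_/= distrC.
exact: closed_ball_closed.
Qed.

(** The field is the constant field [v] of the chart [c] multiplied by a bump function and extended
    by zero. The open sets [chart_dom c] and the complement of the closed set [K] cover [M], and
    smoothness is checked on each. *)
Lemma vector_field_extension c (q : M) (v : 'rV[R]_n) : atlas c -> chart_dom c q ->
  exists X : vector_field M, field_derive X c q = v.
Proof.
move=> ac cq.
have /nbhs_normP[d /= d0 hd] : nbhs (c q) (chart_ran c).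
  by apply: open_nbhs_nbhs; split; [exact: chart_ran_open|exact: chart_mapP].
(* Half the radius is used because the bump function is controlled on a closed ball, while only the
   open ball of radius [d] is known to lie in the range. *)
have ball_ran z : `|z - c q| <= d / 2 -> chart_ran c z.
  move=> h; apply: hd => /=; rewrite distrC (le_lt_trans h)//.
  by rewrite ltr_pdivrMr// ltr_pMr// ltr1n.
have [b [sb bq bsupp]] := @bump_function R n (c q) (d / 2) (divr_gt0 d0 (ltr0n _ 2)).
pose K := chart_inv c @` [set z | `|z - c q| <= d / 2].
have cK : closed K.
  apply: compact_closed; first exact: manifold_hausdorff.
  by apply: compact_chart_ball => //; exact: divr_gt0.
have bK p : chart_dom c p -> ~ K p -> b (c p) = 0.
  move=> cp nKp; apply/eqP; apply: contra_notT nKp => /bsupp h.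
  by exists (c p) => //; rewrite chart_mapK.
(* A tangent vector at [p] is recorded in the chart [chart_at p], so [v] is transported by the
   derivative of the transition map from [c]. *)
pose X (p : M) : tangent p := if `[< chart_dom c p >] then
  'D_(b (c p) *: v) (chart_at p \o chart_inv c) (c p) else 0.
have XE d' p : atlas d' -> chart_dom c p -> chart_dom d' p ->
    field_derive X d' p = b (c p) *: 'D_v (d' \o chart_inv c) (c p).
  move=> ad cp dp; rewrite /field_derive /X asboolT//.
  have ap := chart_at_atlas p; have pp := chart_at_dom p.
  have dd := transition_differentiable ap ad pp dp.
  rewrite -(derive_transition _ ac ap cp pp dd) derive_dirZ//.
  exact: transition_differentiable.
have X0 d' p : ~ K p -> field_derive X d' p = 0.
  move=> nKp; suff X0p : X p = 0 by rewrite /field_derive X0p derive0.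
  by rewrite /X; case: asboolP => // cp; rewrite bK// scale0r derive0.
have smoothX d' : atlas d' -> smooth_on (chart_dom d') (field_derive X d').
  move=> ad e ae k; apply: Ck_local => z [ez dz].
  have [cz|ncz] := pselect (chart_dom c (chart_inv e z)).
  - pose U' := chart_ran e `&` chart_inv e @^-1` (chart_dom d' `&` chart_dom c).
    pose U := chart_ran c `&` chart_inv c @^-1` chart_dom d'.
    have oU' : open U'.
      by apply: open_chart_preim; apply: openI; exact: chart_dom_open.
    have oU : open U by apply: open_chart_preim; exact: chart_dom_open.
    exists U'; first by [].
    pose g z := b z *: 'D_v (d' \o chart_inv c) z.
    have sg : Ck k U g.
      apply: Ck_rV => // i.
      have -> : (fun x => g x 0 i) =
          b * (fun x => 'D_v (d' \o chart_inv c) x 0 i).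
        by apply/funext => x; rewrite /g mxE.
      apply: CkM => //; first by apply: Ck_subset (sb k).
      apply: Ck_coord => //; exact: (smooth_derive v (atlas_compatible ac ad)).
    have st : Ck k U' (c \o chart_inv e).
      by apply: Ck_subset (atlas_compatible ae ac k) => y [ey [_ cy]].
    have : Ck k U' (g \o (c \o chart_inv e)).
      apply: (Ck_comp oU' oU _ st sg) => y [ey [dy cy]].
      exact: chart_ranI.
    apply: (Ck_eq oU') => y [ey [dy cy]].
    by rewrite /comp XE.
  (* [K] lies in the domain of [c], so a point outside that domain has a neighborhood missing [K],
     where the field is zero. *)
  - exists (chart_ran e `&` chart_inv e @^-1` (~` K)).
      split=> //; rewrite /preimage /= => -[y yq yz].
      by apply: ncz; rewrite -yz; apply: chart_invP; exact: ball_ran.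
    have oK : open (chart_ran e `&` chart_inv e @^-1` (~` K)).
      by apply: open_chart_preim; exact: closed_openC.
    apply: (Ck_eq oK) (Ck_cst k _ (0 : 'rV[R]_n)) => y [_ nKy].
    by rewrite /comp X0.
exists (VectorField smoothX).
rewrite (XE _ _ ac cq cq) bq scale1r.
(* Read in [c] itself the transition map is the identity near [c q]. *)
rewrite -[RHS](@derive_id _ _ (c q)).
apply: near_eq_derive.
apply: filterS (near_chart (@chart_dom_open _ _ _ c) cq cq) => z [cz _].
by rewrite /= chart_invK.
Qed.

End VectorFields.

(** * Product manifolds *)

Section FieldCalculus.
Context {R : realType} {n : nat} (M : manifold R n).
Implicit Types (V : forall p : M, tangent p) (f g : M -> R).

Lemma smooth_on_cst (A : set M) (a : R) : smooth_on A (cst a : M -> R).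
Proof. by move=> c ac k; exact: Ck_cst. Qed.

Lemma open_chart_ranT (c : chart R n M) : open (chart_ran c `&` chart_inv c @^-1` setT).
Proof. by apply: open_chart_preim; exact: openT. Qed.

Lemma smooth_onM f g : smooth_on setT f -> smooth_on setT g ->
  smooth_on setT (fun q => f q * g q).
Proof.
move=> sf sg c ac k.
by apply: CkM; [exact: open_chart_ranT|exact: sf|exact: sg].
Qed.

Lemma smooth_on_expR f : smooth_on setT f -> smooth_on setT (fun q => expR (f q)).
Proof.
move=> sf c ac k.
apply: (Ck_comp_R (open_chart_ranT (c := c)) (fun _ _ => I) (sf c ac k)).
exact: Ck_expR.
Qed.

Lemma smooth_on_ln f : (forall q, 0 < f q) -> smooth_on setT f ->
  smooth_on setT (fun q => ln (f q)).
Proof.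
move=> f0 sf c ac k.
apply: (Ck_comp_R (open_chart_ranT (c := c)) _ (sf c ac k) (Ck_ln k)) => z _.
exact: f0.
Qed.

Lemma smooth_on_subset (W : normedModType R) (A B : set M) (f : M -> W) :
  A `<=` B -> smooth_on B f -> smooth_on A f.
Proof. by move=> AB sf c ac; apply: smooth_subset (sf c ac) => z [? /AB]. Qed.

Lemma chart_at_differentiable f p : smooth_on setT f ->
  differentiable (f \o chart_inv (chart_at p)) (chart_at p p).
Proof.
move=> sf; apply: (smooth_on_differentiable sf (chart_at_atlas p)) => //.
exact: chart_at_dom.
Qed.

Lemma field_deriveM V f g p : smooth_on setT f -> smooth_on setT g ->
  field_derive V (fun q => f q * g q) p =
  f p * field_derive V g p + g p * field_derive V f p.
Proof.
move=> sf sg; rewrite /field_derive.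
rewrite [LHS](@deriveM _ _ (f \o chart_inv (chart_at p))
  (g \o chart_inv (chart_at p))).
- by rewrite /= chart_mapK//; exact: chart_at_dom.
- exact/diff_derivable/chart_at_differentiable.
- exact/diff_derivable/chart_at_differentiable.
Qed.

Lemma field_derive_expR V f p : smooth_on setT f ->
  field_derive V (fun q => expR (f q)) p = expR (f p) * field_derive V f p.
Proof.
move=> sf; have df := chart_at_differentiable p sf.
have dE x : differentiable (@expR R) x by exact/derivable1_diffP/derivable_expR.
rewrite {1}/field_derive (derivative_comp (g := expR) (V p) df (dE _)).
rewrite (derive_scale_R _ (dE _)) derive_val mulrC /=.
by rewrite chart_mapK//; exact: chart_at_dom.
Qed.

Lemma field_derive_cst V (a : R) p : field_derive V (cst a) p = 0.
Proof. by rewrite /field_derive; exact: derive_cst. Qed.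

End FieldCalculus.

Lemma within_continuous_postcomp (S T T' : topologicalType) (A : set S)
    (f : S -> T) (g : T -> T') :
  {within A, continuous f} -> continuous g -> {within A, continuous (g \o f)}.
Proof. by move=> cf cg x; exact: (continuous_comp (cf x) (cg _)). Qed.

Section ProductManifold.
Context {R : realType} {n1 n2 : nat} (M1 : manifold R n1) (M2 : manifold R n2).
Local Notation M := (prod_manifold M1 M2).

Lemma prod_chart_atlas (c1 : chart R n1 M1) (c2 : chart R n2 M2) :
  atlas c1 -> atlas c2 -> @atlas _ _ M (prod_chart c1 c2).
Proof. by move=> a1 a2; exists (c1, c2). Qed.

Section Charts.
Context (c1 : chart R n1 M1) (c2 : chart R n2 M2).
Hypotheses (a1 : atlas c1) (a2 : atlas c2).
Let ac := prod_chart_atlas a1 a2.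

Lemma field_derive_hlift (X : vector_field M1) (p : M) :
  chart_dom (prod_chart c1 c2) p ->
  field_derive (horizontal_lift M2 X) (prod_chart c1 c2) p =
  inl_rV n2 (field_derive X c1 p.1).
Proof.
move=> cp; rewrite (field_derive_row_mx _ a1 a2 cp) /= /hlift_val.
by rewrite row_mxKl row_mxKr derive0.
Qed.

Lemma field_derive_vlift (U : vector_field M2) (p : M) :
  chart_dom (prod_chart c1 c2) p ->
  field_derive (vertical_lift M1 U) (prod_chart c1 c2) p =
  inr_rV n1 (field_derive U c2 p.2).
Proof.
move=> cp; rewrite (field_derive_row_mx _ a1 a2 cp) /= /vlift_val.
by rewrite row_mxKl row_mxKr derive0.
Qed.

(** Along a vertical line the base coordinate is fixed, so the components of the horizontal lift
    stay constant, as [field_derive2_chart] requires. *)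
Lemma vlift_hlift_chart (X : vector_field M1) (U : vector_field M2) (h : M -> R)
    (p : M) : smooth_on setT h -> chart_dom (prod_chart c1 c2) p ->
  field_derive (vertical_lift M1 U) (field_derive (horizontal_lift M2 X) h) p =
  'D_(inr_rV n1 (field_derive U c2 p.2)) ('D_(inl_rV n2 (field_derive X c1 p.1))
    (h \o chart_inv (prod_chart c1 c2))) (prod_chart c1 c2 p).
Proof.
move=> sh cp.
have Xp := field_derive_hlift X cp; have Up := field_derive_vlift U cp.
rewrite -Xp -Up; apply: (field_derive2_chart sh ac cp); rewrite Xp Up.
apply: filterS (@near_line_chart _ _ M _ _
  (inr_rV n1 (field_derive U c2 p.2)) cp) => t ct.
rewrite (field_derive_hlift X (chart_invP ct)) /=.
rewrite linearD linearZ /= row_mxKl row_mxKl scaler0 add0r.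
by rewrite chart_mapK//; case: cp.
Qed.

Lemma hlift_vlift_chart (X : vector_field M1) (U : vector_field M2) (h : M -> R)
    (p : M) : smooth_on setT h -> chart_dom (prod_chart c1 c2) p ->
  field_derive (horizontal_lift M2 X) (field_derive (vertical_lift M1 U) h) p =
  'D_(inl_rV n2 (field_derive X c1 p.1)) ('D_(inr_rV n1 (field_derive U c2 p.2))
    (h \o chart_inv (prod_chart c1 c2))) (prod_chart c1 c2 p).
Proof.
move=> sh cp.
have Xp := field_derive_hlift X cp; have Up := field_derive_vlift U cp.
rewrite -Xp -Up; apply: (field_derive2_chart sh ac cp); rewrite Xp Up.
apply: filterS (@near_line_chart _ _ M _ _
  (inl_rV n2 (field_derive X c1 p.1)) cp) => t ct.
rewrite (field_derive_vlift U (chart_invP ct)) /=.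
rewrite linearD linearZ /= row_mxKr row_mxKr scaler0 add0r.
by rewrite chart_mapK//; case: cp.
Qed.

End Charts.

(** Both sides are the same mixed second derivative in a product chart, up to the order of
    differentiation. *)
Lemma lifts_commute (X : vector_field M1) (U : vector_field M2) (h : M -> R)
    (p : M) : smooth_on setT h ->
  field_derive (horizontal_lift M2 X) (field_derive (vertical_lift M1 U) h) p =
  field_derive (vertical_lift M1 U) (field_derive (horizontal_lift M2 X) h) p.
Proof.
move=> sh; have cp := prod_chart_at_dom p.
have b1 := chart_at_atlas p.1; have b2 := chart_at_atlas p.2.
rewrite (hlift_vlift_chart b1 b2 X U sh cp) (vlift_hlift_chart b1 b2 X U sh cp).
apply: (derive_comm _ _ (@chart_ran_open _ _ _ (prod_chart_at p)))
  (smooth_on_chart sh (prod_chart_atlas b1 b2) 2) _.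
exact: chart_mapP.
Qed.

Lemma smooth_on_snd (s : M2 -> R) :
  smooth_on setT s -> @smooth_on _ _ M _ setT (fun q => s q.2).
Proof.
move=> ss _ [[c1 c2] [/= a1 a2] <-] k.
apply: (Ck_subset _ (Ck_precomp (@continuous_rsubmx _ _ _ _) (ss c2 a2 k))).
by move=> z [[z1 z2] _].
Qed.

Lemma hlift_snd (X : vector_field M1) (s : M2 -> R) : smooth_on setT s ->
  field_derive (horizontal_lift M2 X) (fun q : M => s q.2) = cst 0.
Proof.
move=> ss; apply/funext => p; have cp := prod_chart_at_dom p.
have b1 := chart_at_atlas p.1; have b2 := chart_at_atlas p.2.
rewrite (field_derive_chart _ (prod_chart_atlas b1 b2) cp); last first.
  exact: (smooth_on_differentiable (smooth_on_snd ss) (prod_chart_atlas b1 b2)).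
rewrite (field_derive_hlift b1 b2 X cp).
rewrite -[_ \o _]/((s \o chart_inv (chart_at p.2)) \o rsubmx).
rewrite derive_precomp [X in 'D_X _ _](_ : _ = 0) ?derive0//; exact: row_mxKr.
Qed.

Lemma smooth_on_slice_fst (h : M -> R) (y : M2) :
  smooth_on setT h -> @smooth_on _ _ M1 _ setT (fun x => h (x, y)).
Proof.
move=> sh c1 a1 k; pose c2 := chart_at y.
have a2 : atlas c2 by exact: chart_at_atlas.
have cy : chart_dom c2 y by exact: chart_at_dom.
have sk := smooth_on_chart sh (prod_chart_atlas a1 a2) k.
pose r (z : 'rV[R]_n1) := row_mx z (c2 y).
have rk : Ck k (chart_ran c1 `&` chart_inv c1 @^-1` setT) r.
  apply: Ck_row_mx; [exact: open_chart_ranT|exact: Ck_id|exact: Ck_cst].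
have := Ck_comp_rV (open_chart_ranT (c := c1)) _ rk sk.
rewrite (_ : (_ \o chart_inv (prod_chart c1 c2)) \o r =
  (fun x => h (x, y)) \o chart_inv c1); first apply.
  move=> z [cz _]; split; rewrite /preimage /= /r ?row_mxKl ?row_mxKr//.
  exact: chart_mapP.
by apply/funext => z; rewrite /= /prod_chart_inv /r row_mxKl row_mxKr chart_mapK.
Qed.

Lemma smooth_on_slice_snd (h : M -> R) (x : M1) :
  smooth_on setT h -> @smooth_on _ _ M2 _ setT (fun y => h (x, y)).
Proof.
move=> sh c2 a2 k; pose c1 := chart_at x.
have a1 : atlas c1 by exact: chart_at_atlas.
have cx : chart_dom c1 x by exact: chart_at_dom.
have sk := smooth_on_chart sh (prod_chart_atlas a1 a2) k.
pose r (z : 'rV[R]_n2) := row_mx (c1 x) z.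
have rk : Ck k (chart_ran c2 `&` chart_inv c2 @^-1` setT) r.
  apply: Ck_row_mx; [exact: open_chart_ranT|exact: Ck_cst|exact: Ck_id].
have := Ck_comp_rV (open_chart_ranT (c := c2)) _ rk sk.
rewrite (_ : (_ \o chart_inv (prod_chart c1 c2)) \o r =
  (fun y => h (x, y)) \o chart_inv c2); first apply.
  move=> z [cz _]; split; rewrite /preimage /= /r ?row_mxKl ?row_mxKr//.
  exact: chart_mapP.
by apply/funext => z; rewrite /= /prod_chart_inv /r row_mxKl row_mxKr chart_mapK.
Qed.

Lemma derive_slice_fst (f : 'rV[R]_(n1 + n2) -> R) (a v : 'rV[R]_n1)
    (b : 'rV[R]_n2) :
  'D_v (fun z => f (row_mx z b)) a = 'D_(inl_rV n2 v) f (row_mx a b).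
Proof.
suff e : (fun t : R => t^-1 *: (f (row_mx (t *: v + a) b) - f (row_mx a b))) =
    (fun t : R => t^-1 *: (f (t *: inl_rV n2 v + row_mx a b) - f (row_mx a b))).
  by rewrite /derive /= e.
apply/funext => t; congr (_ *: (f _ - _)).
by rewrite /inl_rV scale_row_mx add_row_mx scaler0 add0r.
Qed.

Lemma derive_slice_snd (f : 'rV[R]_(n1 + n2) -> R) (a : 'rV[R]_n1)
    (b v : 'rV[R]_n2) :
  'D_v (fun z => f (row_mx a z)) b = 'D_(inr_rV n1 v) f (row_mx a b).
Proof.
suff e : (fun t : R => t^-1 *: (f (row_mx a (t *: v + b)) - f (row_mx a b))) =
    (fun t : R => t^-1 *: (f (t *: inr_rV n1 v + row_mx a b) - f (row_mx a b))).
  by rewrite /derive /= e.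
apply/funext => t; congr (_ *: (f _ - _)).
by rewrite /inr_rV scale_row_mx add_row_mx scaler0 add0r.
Qed.

Lemma differentiable_slice_snd (f : 'rV[R]_(n1 + n2) -> R) (a : 'rV[R]_n1)
    (b : 'rV[R]_n2) :
  differentiable f (row_mx a b) -> differentiable (fun z => f (row_mx a z)) b.
Proof.
move=> df; apply: (@differentiable_comp _ _ _ _ (fun z => row_mx a z)) => //.
by have [+ _] := Ck_row_mx openT (Ck_cst 1 setT a) (@Ck_id R 'rV[R]_n2 1 setT); apply.
Qed.

(** Taking the difference of two slices turns equality of their [x]-derivatives into a vanishing
    derivative, so one constancy principle serves both variables. The inner application fixes a
    point, a chart and a direction [v] on the first factor and lets only [y] vary. *)
Lemma mixed_derivative0_separates (h : M -> R) (W1 : set M1) (W2 : set M2) :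
  smooth_on setT h -> open W1 -> path_connected R W1 ->
  open W2 -> path_connected R W2 ->
  (forall (X : vector_field M1) (U : vector_field M2) (p : M),
    field_derive (vertical_lift M1 U) (field_derive (horizontal_lift M2 X) h) p
      = 0) ->
  forall x x' y y', W1 x -> W1 x' -> W2 y -> W2 y' ->
    h (x, y) - h (x, y') = h (x', y) - h (x', y').
Proof.
move=> sh oW1 pW1 oW2 pW2 h0 x x' y y' Wx Wx' Wy Wy'.
apply: (zero_derivative_constant (h := fun x => h (x, y) - h (x, y')) oW1 pW1) => //.
move=> c1 {Wx Wx'}x {x'} a1 cx Wx.
have dslice z : differentiable ((fun x => h (x, z)) \o chart_inv c1) (c1 x).
  exact: (smooth_on_differentiable (smooth_on_slice_fst z sh)).
split=> [|v]; first exact: (differentiableB (dslice y) (dslice y')).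
rewrite [LHS](@deriveB _ _ _ ((fun x => h (x, y)) \o chart_inv c1)
  ((fun x => h (x, y')) \o chart_inv c1)); last 2 first.
- exact/diff_derivable/dslice.
- exact/diff_derivable/dslice.
apply/eqP; rewrite subr_eq0; apply/eqP.
apply: (zero_derivative_constant
  (h := fun y => 'D_v ((fun x => h (x, y)) \o chart_inv c1) (c1 x)) oW2 pW2) => //.
move=> c2 {Wy Wy'}y {y'} a2 cy Wy.
pose F := h \o chart_inv (prod_chart c1 c2).
have -> : (fun y => 'D_v ((fun x => h (x, y)) \o chart_inv c1) (c1 x)) \o
    chart_inv c2 = (fun z => 'D_(inl_rV n2 v) F (row_mx (c1 x) z)).
  have slice z : (fun w => F (row_mx w z)) =
      (fun x => h (x, chart_inv c2 z)) \o chart_inv c1.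
    by apply/funext => w; rewrite /F /= /prod_chart_inv row_mxKl row_mxKr.
  by apply/funext => z; rewrite -(derive_slice_fst F (c1 x) v z) slice.
have cp : chart_dom (prod_chart c1 c2) ((x, y) : M) by split.
have sF := smooth_on_chart sh (prod_chart_atlas a1 a2).
split=> [|w].
  apply: (differentiable_slice_snd (f := 'D_(inl_rV n2 v) F)).
  apply: (smooth_differentiable (smooth_derive (inl_rV n2 v) sF)).
  exact: (chart_mapP cp).
rewrite (derive_slice_snd ('D_(inl_rV n2 v) F)).
have [X Xv] := vector_field_extension v a1 cx.
have [U Uw] := vector_field_extension w a2 cy.
by rewrite -(h0 X U (x, y)) (vlift_hlift_chart a1 a2 X U sh cp) /= Xv Uw.
Qed.

Lemma path_connected_fst (A : set M1) (B : set M2) :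
  path_connected R (A `*` B) -> path_connected R A.
Proof.
move=> [[[a b] [/= Aa Bb]] AB]; split; first by exists a.
move=> x y Ax Ay.
have [g [cg gAB g0 g1]] := AB (x, b) (y, b) (conj Ax Bb) (conj Ay Bb).
exists (fst \o g); split; rewrite /= ?g0 ?g1//.
- by apply: (within_continuous_postcomp cg) => ?; exact: cvg_fst.
- by move=> _ [t t01 <-] /=; have [] := gAB (g t) (ex_intro2 _ _ t t01 erefl).
Qed.

Lemma path_connected_snd (A : set M1) (B : set M2) :
  path_connected R (A `*` B) -> path_connected R B.
Proof.
move=> [[[a b] [/= Aa Bb]] AB]; split; first by exists b.
move=> x y Bx By.
have [g [cg gAB g0 g1]] := AB (a, x) (a, y) (conj Aa Bx) (conj Aa By).
exists (snd \o g); split; rewrite /= ?g0 ?g1//.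
- by apply: (within_continuous_postcomp cg) => ?; exact: cvg_snd.
- by move=> _ [t t01 <-] /=; have [] := gAB (g t) (ex_intro2 _ _ t t01 erefl).
Qed.

End ProductManifold.

(** * Fiber-dependent Lyra scale *)

(** Dictionary: [m = n2 - 1], [n = n1 + n2 - 2], [a = alpha], [e = E]; the remaining letters spell
    derivatives, so [xk] is [X k], [us] is [U sigma], [xus] is [X (U sigma)], [uxk] is [U (X k)],
    [ue] is [U E] and [uexk] is [U (E * X k)]. The constant [alpha] is the one for which [m * ue]
    produces the coefficient [n] of [X k * U sigma]. *)
Lemma weighted_mixed_algebra (R : realType)
    (m n a e xk us xs xus xuk uxk uexk ue : R) :
  xs = 0 -> xus = 0 -> xuk = uxk -> uexk = e * uxk + xk * ue ->
  ue = e * (- a * us) -> n = a * m ->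
  m * uexk = e * (m * xuk + n * (xus - xk * us - xs * us)).
Proof. by move=> -> -> -> -> -> ->; ring. Qed.

Section FiberScale.
Context {R : realType} {n1 n2 : nat} (L : lyra_twisted_warped_product R n1 n2).
Context (sigma2 : fiber L -> R).
Hypotheses (hn2 : (1 < n2)%N) (hsigma2 : smooth_on setT sigma2).
Hypothesis hsigma : forall p : total_space L, log_scale L p = sigma2 p.2.

Let k : total_space L -> R := log_warping L.
Let alpha : R := ((n1 + n2)%:R - 2) / (n2%:R - 1).
Let E : total_space L -> R := fun q => expR (- alpha * sigma2 q.2).

Lemma log_warping_smooth : smooth_on setT k.
Proof.
by apply: smooth_on_ln; [exact: warping_gt0|exact: warping_smooth].
Qed.

Lemma fiber_scale_smooth : @smooth_on _ _ (total_space L) _ setT (fun q => sigma2 q.2).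
Proof. exact: smooth_on_snd. Qed.

Lemma fiber_exponent_smooth :
  @smooth_on _ _ (total_space L) _ setT (fun q => - alpha * sigma2 q.2).
Proof.
apply: (smooth_onM (f := cst (- alpha))); first exact: smooth_on_cst.
exact: fiber_scale_smooth.
Qed.

Lemma fiber_weight_smooth : smooth_on setT E.
Proof. exact: smooth_on_expR fiber_exponent_smooth. Qed.

Lemma vfield_fiber_weight (U : vector_field (fiber L)) (p : total_space L) :
  field_derive (vfield U) E p =
  E p * (- alpha * field_derive (vfield U) (fun q => sigma2 q.2) p).
Proof.
rewrite (field_derive_expR _ _ fiber_exponent_smooth); congr (_ * _).
rewrite (field_deriveM (f := cst (- alpha)) _ _ (smooth_on_cst _ _) fiber_scale_smooth).
by rewrite field_derive_cst mulr0 addr0.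
Qed.

(** [X E = 0] because [E] depends only on the fiber. Thus the weighted equation is a mixed second
    derivative of the single function [E * k]. *)
Lemma hfield_weighted (X : vector_field (base L)) (p : total_space L) :
  field_derive (hfield X) (fun q => E q * k q) p = E p * field_derive (hfield X) k p.
Proof.
rewrite (field_deriveM _ _ fiber_weight_smooth log_warping_smooth).
have sE : smooth_on setT (fun y : fiber L => expR (- alpha * sigma2 y)).
  apply: smooth_on_expR; apply: (smooth_onM (f := cst (- alpha))) => //.
  exact: smooth_on_cst.
have /(congr1 (@^~ p)) /= XE := hlift_snd X sE.
by rewrite /E /hfield XE mulr0 addr0.
Qed.

Lemma fiber_codim_neq0 : n2%:R - 1 != 0 :> R.
Proof. by rewrite subr_eq0 pnatr_eq1 gtn_eqF. Qed.

Lemma dim_alpha : (n1 + n2)%:R - 2 = alpha * (n2%:R - 1).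
Proof. by rewrite /alpha mulfVK// fiber_codim_neq0. Qed.

(** An identity that does not presuppose the soliton equation. The factors [n2 - 1] and [E p] are
    nonzero, so cancelling one or the other yields each direction of the equivalence. *)
Lemma weighted_mixed_derivative (X0 : vector_field (base L))
    (U0 : vector_field (fiber L)) (p : total_space L) :
  let X := field_derive (hfield X0) in
  let U := field_derive (vfield U0) in
  (n2%:R - 1) * U (fun q => E q * X k q) p =
  E p * ((n2%:R - 1) * X (U k) p + ((n1 + n2)%:R - 2) *
    (X (U (log_scale L)) p - X k p * U (log_scale L) p
      - X (log_scale L) p * U (log_scale L) p)).
Proof.
move=> X U.
have -> : log_scale L = (fun q => sigma2 q.2) by apply/funext.
have Xs : X (fun q => sigma2 q.2) p = 0.
  exact: (congr1 (fun h => h p) (hlift_snd X0 hsigma2)).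
have XUs : X (U (fun q => sigma2 q.2)) p = 0.
  apply: (etrans (lifts_commute X0 U0 p fiber_scale_smooth)).
  by rewrite (hlift_snd X0 hsigma2) field_derive_cst.
have XUk : X (U k) p = U (X k) p by exact: (lifts_commute X0 U0 p log_warping_smooth).
have UEXk : U (fun q => E q * X k q) p = E p * U (X k) p + X k p * U E p.
  exact: (field_deriveM _ _ fiber_weight_smooth
    (smooth_on_field_derive (hfield X0) log_warping_smooth)).
have UE : U E p = E p * (- alpha * U (fun q => sigma2 q.2) p).
  exact: vfield_fiber_weight.
exact: weighted_mixed_algebra Xs XUs XUk UEXk UE dim_alpha.
Qed.

Lemma mixed_soliton_equationP :
  mixed_soliton_equation L <->
  forall (X0 : vector_field (base L)) (U0 : vector_field (fiber L))
    (p : total_space L),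
    field_derive (vfield U0) (fun q => E q * field_derive (hfield X0) k q) p = 0.
Proof.
split=> h; [move=> X0 U0 p|move=> X0 U0 p];
  have e := weighted_mixed_derivative X0 U0 p.
- move: e; rewrite /= [X in E p * X](h X0 U0 p) mulr0 => /eqP.
  by rewrite mulf_eq0 (negbTE fiber_codim_neq0) => /eqP.
- move: e; rewrite /= h mulr0 => /esym/eqP.
  by rewrite mulf_eq0 gt_eqF ?expR_gt0// => /eqP.
Qed.

(** [E] takes the same value at [(x, y)] and [(x0, y)], so the difference of [E * k] there is [E]
    times the difference of [k]. Multiplying by [expR (alpha * sigma2 y)] therefore leaves
    [k (x0, y)] without a weight. *)
Lemma mixed_soliton_separates (W1 : set (base L)) (W2 : set (fiber L)) x0 y0 :
  mixed_soliton_equation L -> open W1 -> open W2 ->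
  path_connected R (W1 `*` W2) -> W1 x0 -> W2 y0 ->
  forall x y, W1 x -> W2 y -> k (x, y) =
    expR (alpha * sigma2 y) *
      (expR (- alpha * sigma2 y0) * (k (x, y0) - k (x0, y0))) + k (x0, y).
Proof.
move=> hE oW1 oW2 pW Wx0 Wy0 x y Wx Wy.
have sG := smooth_onM fiber_weight_smooth log_warping_smooth.
have h0 X U p : field_derive (vertical_lift (base L) U)
    (field_derive (horizontal_lift (fiber L) X) (fun q => E q * k q)) p = 0.
  have -> : field_derive (horizontal_lift (fiber L) X) (fun q => E q * k q) =
      (fun q => E q * field_derive (hfield X) k q).
    by apply/funext => q; exact: hfield_weighted.
  exact: (mixed_soliton_equationP.1 hE).
have sep := mixed_derivative0_separates sG oW1 (path_connected_fst pW) oW2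
  (path_connected_snd pW) h0 Wx Wx0 Wy Wy0.
have {}sep : expR (- alpha * sigma2 y) * (k (x, y) - k (x0, y)) =
    expR (- alpha * sigma2 y0) * (k (x, y0) - k (x0, y0)).
  by move: sep; rewrite /E /= !mulrBr => sep; lra.
by rewrite -sep mulrA -expRD mulNr addrN expR0 mul1r subrK.
Qed.

End FiberScale.

Unset Implicit Arguments.

Theorem theorem4p4 (R : realType) (n1 n2 : nat)
    (L : lyra_twisted_warped_product R n1 n2) (hn2 : (1 < n2)%N)
    (sigma2 : fiber L -> R) (hsigma2 : smooth_on setT sigma2)
    (hsigma : forall p : total_space L, log_scale L p = sigma2 p.2) :
  let k : total_space L -> R := log_warping L in
  let alpha : R := ((n1 + n2)%:R - 2) / (n2%:R - 1) in
  (mixed_soliton_equation L <->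
   forall (X0 : vector_field (base L)) (U0 : vector_field (fiber L))
     (p : total_space L),
     let X := field_derive (hfield X0) in
     let U := field_derive (vfield U0) in
     U (fun q => expR (- alpha * sigma2 q.2) * X k q) p = 0)
  /\
  (mixed_soliton_equation L ->
   forall (W1 : set (base L)) (W2 : set (fiber L)),
     open W1 -> open W2 -> simply_connected R (W1 `*` W2) ->
     exists (k1 : base L -> R) (k2 : fiber L -> R),
       [/\ smooth_on W1 k1, smooth_on W2 k2,
           (forall x y, W1 x -> W2 y ->
              k (x, y) = expR (alpha * sigma2 y) * k1 x + k2 y)
         & (let f2 := fun y => expR (k2 y) in
            forall x y, W1 x -> W2 y ->
              warping L (x, y) =
              f2 y * expR (expR (alpha * sigma2 y) * k1 x))]).
Proof.
move=> k alpha; split; first exact: (mixed_soliton_equationP hn2 hsigma2 hsigma).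
move=> hE W1 W2 oW1 oW2 [pW _].
have [[[x0 y0] [/= Wx0 Wy0]] _] := pW.
(* The base point [(x0, y0)] comes from nonemptiness of the product and fixes the normalization
   [k1 x0 = 0], [k2 = k (x0, -)]; the factor in [k1] is the weight [E] at [y0]. *)
pose k1 x := expR (- alpha * sigma2 y0) * (k (x, y0) - k (x0, y0)).
pose k2 y := k (x0, y).
have sk : smooth_on setT k by exact: log_warping_smooth.
have kE x y : W1 x -> W2 y ->
    k (x, y) = expR (alpha * sigma2 y) * k1 x + k2 y.
  exact: (mixed_soliton_separates hn2 hsigma2 hsigma hE oW1 oW2 pW).
exists k1, k2; split=> //.
- move=> c ac j; apply: (@Ck_subset _ _ _ _ (chart_ran c `&` chart_inv c @^-1` setT)).
    by move=> z [].
  have oc := open_chart_ranT (c := c).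
  apply: (CkM oc (Ck_cst j _ (expR (- alpha * sigma2 y0) : R))).
  apply: (CkD oc _ (Ck_cst j _ (- k (x0, y0) : R))).
  exact: (smooth_on_slice_fst y0 sk ac j).
- apply: (@smooth_on_subset _ _ _ _ W2 setT k2); first by [].
  exact: (smooth_on_slice_snd x0 sk).
- move=> x y Wx Wy.
  rewrite -[LHS](lnK (warping_gt0 (l := L) (x, y))) -[ln _]/(k (x, y)) kE//.
  by rewrite expRD mulrC.
Qed.
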